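(* For every $\pi\in S(\mathbb{Z}_{25})$ there exist a subset $A\subseteq\mathbb{Z}_{25}$ with $2\leq|A|\leq 7$ and an element $i\in\mathbb{Z}_{25}$ such that $\pi(A)=A+i$. Moreover, there exist $\pi\in S(\mathbb{Z}_{25})$ such that $x\mapsto\pi(x)-x$ is a permutation of $\mathbb{Z}_{25}$ and, for every $k\in\mathbb{Z}_{25}$, the permutation $x\mapsto\pi(x+k)$ has no cycle of length $2,3,4,5$ or $6$.
   Context: $S(\mathbb{Z}_n)$ denotes the set of bijections $\mathbb{Z}_n\to\mathbb{Z}_n$; $A+i=\{a+i:a\in A\}$. *)

(* Defs.v *)
From mathcomp Require Import all_boot all_order all_algebra all_fingroup.
Set Implicit Arguments. Unset Strict Implicit. Unset Printing Implicit Defensive.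
Import GRing.Theory.
Local Open Scope ring_scope.

Definition Z25 := 'Z_25.

Definition translate (A : {set Z25}) (i : Z25) : {set Z25} := [set a + i | a in A].

Definition shifted (pi : {perm Z25}) (k : Z25) : Z25 -> Z25 := fun x => pi (x + k).

Definition no_short_cycle (f : Z25 -> Z25) : Prop :=
  forall x : Z25, ~ (2 <= fingraph.order f x <= 6)%N.

(* Main.v *)
(* Let [f z = p z - i]. A set [A] satisfies [p(A) = A + i] as soon as it is a union of cycles of [f]. So if
   [p] has no such set of size 2 to 7, no [f] has two fixed points or a cycle of length 2 to 7; in particular
   [p z - z] and [p z + z] are injective, i.e. the graph of [p] is a configuration of 25 nonattacking queens
   on a toroidal board. Such acyclic configurations are permuted by the maps [c => u c + t] and by the
   transposition of the board. Their numbers of queens in the 25 classes of cells modulo 5, the boxes, have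
   constant sums along the lines of the 5 x 5 torus, which leaves 23 cases up to symmetry. In each of them,
   translating by multiples of 5 brings a queen to a prescribed cell, from which an exhaustive case analysis
   reaches a contradiction: a line without queens has no cell left that is not attacked, does not close a
   short cycle and does not complete the image under a symmetry of a configuration refuted before. The case
   analyses are found by an untrusted search, which records them in certificates, and replayed by a verified
   checker. *)
Require Import Defs.
From HB Require Import structures.
From mathcomp Require Import all_boot all_order all_algebra all_fingroup.
From mathcomp Require Import zify ring.
From Stdlib Require Import Strings.Byte.
Import GRing.Theory.
Set Implicit Arguments.
Unset Strict Implicit.
Unset Printing Implicit Defensive.
Local Open Scope nat_scope.

(** * The ring of integers modulo 25, with operations computed by table lookup *)

Inductive z25 : Set :=
  z0 | z1 | z2 | z3 | z4 | z5 | z6 | z7 | z8 | z9 | z10 | z11 | z12 | z13 |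
  z14 | z15 | z16 | z17 | z18 | z19 | z20 | z21 | z22 | z23 | z24.

Definition z25s : seq z25 :=
  [:: z0; z1; z2; z3; z4; z5; z6; z7; z8; z9; z10; z11; z12; z13; z14; z15; z16;
  z17; z18; z19; z20; z21; z22; z23; z24].

Coercion nat_of_z25 (z : z25) : nat :=
  match z with
  | z0 => 0 | z1 => 1 | z2 => 2 | z3 => 3 | z4 => 4 | z5 => 5 | z6 => 6
  | z7 => 7 | z8 => 8 | z9 => 9 | z10 => 10 | z11 => 11 | z12 => 12
  | z13 => 13 | z14 => 14 | z15 => 15 | z16 => 16 | z17 => 17 | z18 => 18
  | z19 => 19 | z20 => 20 | z21 => 21 | z22 => 22 | z23 => 23 | z24 => 24
  end.

Definition z25_of_nat (n : nat) : z25 := nth z0 z25s (n %% 25).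

Lemma nat_of_z25K : cancel nat_of_z25 z25_of_nat. Proof. by case. Qed.

Lemma ltn_z25 (z : z25) : z < 25. Proof. by case: z. Qed.

Lemma z25_of_natK n : z25_of_nat n = n %% 25 :> nat.
Proof.
have /allP/(_ (n %% 25)) : all (fun m => nat_of_z25 (nth z0 z25s m) == m) (iota 0 25) by [].
by rewrite mem_iota ltn_pmod // => /(_ isT) /eqP.
Qed.

Definition ord_of_z25 (z : z25) : 'I_25 := Ordinal (ltn_z25 z).
Lemma ord_of_z25K : cancel ord_of_z25 (fun i : 'I_25 => z25_of_nat i).
Proof. exact: nat_of_z25K. Qed.

HB.instance Definition _ := Finite.copy z25 (can_type ord_of_z25K).

Lemma mem_z25s z : z \in z25s. Proof. by case: z; vm_compute. Qed.

Lemma forall_z25 (P : pred z25) : all P z25s -> forall a, P a.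
Proof. by move=> /allP allP a; apply/allP/mem_z25s. Qed.

Lemma forall_z25_2 (P : z25 -> pred z25) :
  all (fun a => all (P a) z25s) z25s -> forall a b, P a b.
Proof. by move=> allP a; apply: forall_z25; move: a; apply: forall_z25. Qed.

Lemma forall_z25_3 (P : z25 -> z25 -> pred z25) :
  all (fun a => all (fun b => all (P a b) z25s) z25s) z25s -> forall a b c, P a b c.
Proof. by move=> allP a; apply: forall_z25_2; move: a; apply: forall_z25. Qed.

Ltac by_inspection :=
  apply: (elimT eqP);
  repeat match goal with a : z25 |- _ => match goal with |- context [a] => generalize a end end;
  (apply: forall_z25_3 || apply: forall_z25_2 || apply: forall_z25);
  by vm_compute.

(* A function extensionally equal to [f] whose case analysis comes first, so that normalizing it yields a
   lookup table. *)
Definition tab25 (A : Type) (f : z25 -> A) (z : z25) : A :=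
  ltac:(pose fz := f z; destruct z; exact fz).
Definition tab25_2 (A : Type) (f : z25 -> z25 -> A) (a b : z25) : A :=
  tab25 (fun a => tab25 (f a) b) a.

Definition zadd : z25 -> z25 -> z25 := Eval vm_compute in tab25_2 (fun a b => z25_of_nat (a + b)).
Definition zsub : z25 -> z25 -> z25 := Eval vm_compute in tab25_2 (fun a b => z25_of_nat (a + (25 - b))).
Definition zmul : z25 -> z25 -> z25 := Eval vm_compute in tab25_2 (fun a b => z25_of_nat (a * b)).
Definition zopp : z25 -> z25 := Eval vm_compute in tab25 (fun a => z25_of_nat (25 - a)).
Definition zunit : pred z25 := Eval vm_compute in tab25 (fun a => ~~ (5 %| a)).
Definition zinv : z25 -> z25 := Eval vm_compute in
  tab25 (fun a => if 5 %| a then a else z25_of_nat (find (fun b => a * b == 1 %[mod 25]) (iota 0 25))).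
Definition zeq : rel z25 := Eval vm_compute in tab25_2 (fun a b => nat_of_z25 a == b).

Fact zaddA : associative zadd. Proof. move=> a b c; by_inspection. Qed.
Fact zaddC : commutative zadd. Proof. move=> a b; by_inspection. Qed.
Fact zadd0 : left_id z0 zadd. Proof. by case. Qed.
Fact zaddN : left_inverse z0 zopp zadd. Proof. by case. Qed.

HB.instance Definition _ := GRing.isZmodule.Build z25 zaddA zaddC zadd0 zaddN.

Fact zmulA : associative zmul. Proof. move=> a b c; by_inspection. Qed.
Fact zmulC : commutative zmul. Proof. move=> a b; by_inspection. Qed.
Fact zmul1 : left_id z1 zmul. Proof. by case. Qed.
Fact zmulDl : left_distributive zmul zadd. Proof. move=> a b c; by_inspection. Qed.
Fact z1_neq0 : z1 != z0. Proof. by []. Qed.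

HB.instance Definition _ := GRing.Zmodule_isComNzRing.Build z25 zmulA zmulC zmul1 zmulDl z1_neq0.

Fact zmulV : {in zunit, left_inverse 1%R zinv *%R}. Proof. by case. Qed.
Fact zunitP (a b : z25) : (b * a = 1)%R -> a \in zunit.
Proof. by move/eqP; apply/implyP; by_inspection. Qed.
Fact zinv_out : {in [predC zunit], zinv =1 id}. Proof. by case. Qed.

HB.instance Definition _ := GRing.ComNzRing_hasMulInverse.Build z25 zmulV zunitP zinv_out.

Lemma zsubE (a b : z25) : zsub a b = (a - b)%R. Proof. by_inspection. Qed.

Lemma zeqE a b : zeq a b = (a == b). Proof. by_inspection. Qed.

Lemma addzz_inj : injective (fun a : z25 => a + a)%R.
Proof. by move=> a b /eqP eq_dbl; apply/eqP; move: eq_dbl; apply/implyP; by_inspection. Qed.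

(** * Acyclic configurations of queens *)

Definition quo (z : z25) : nat := z %/ 5.
Definition res (z : z25) : nat := z %% 5.

Lemma quo_lt z : quo z < 5. Proof. by case: z. Qed.

Lemma res_lt z : res z < 5. Proof. exact: ltn_pmod. Qed.

Lemma z25_eqE (a b : z25) : (a == b) = (quo a == quo b) && (res a == res b).
Proof. by_inspection. Qed.

Lemma res_of_nat n : res (z25_of_nat n) = n %% 5.
Proof. by rewrite /res z25_of_natK modn_dvdm. Qed.

Lemma res_add (a b : z25) : res (a + b)%R = (res a + res b) %% 5.
Proof. by_inspection. Qed.

Lemma res_mul (a b : z25) : res (a * b)%R = (res a * res b) %% 5.
Proof. by_inspection. Qed.

(* The box of the cell [(x, y)] is the class of [(x, y)] modulo 5; it has number [5 a + b] when
   [(x, y) = (a, b)] modulo 5. *)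
Definition zbox : z25 -> z25 -> z25 := Eval vm_compute in tab25_2 (fun x y => z25_of_nat (5 * res x + res y)).
Definition box_corner (k : z25) : z25 * z25 := (z25_of_nat (quo k), z25_of_nat (res k)).

Lemma quo_zbox x y : quo (zbox x y) = res x. Proof. by_inspection. Qed.

Lemma res_zbox x y : res (zbox x y) = res y. Proof. by_inspection. Qed.

Lemma zbox_corner k : zbox (box_corner k).1 (box_corner k).2 = k. Proof. by case: k. Qed.

Lemma zbox_eqE x y x' y' : (zbox x y == zbox x' y') = (res x == res x') && (res y == res y').
Proof. by rewrite z25_eqE !quo_zbox !res_zbox. Qed.

Record acyclic_queens (p : z25 -> z25) : Prop := AcyclicQueens {
  queens_inj : injective p;
  queens_sub_inj : injective (fun x => p x - x)%R;
  queens_acyclic : forall (i x : z25) m, 0 < m <= 7 ->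
    iter m (fun z => p z - i)%R x = x -> (p x - i)%R = x }.

Lemma queens_add_inj p : acyclic_queens p -> injective (fun x : z25 => x + p x)%R.
Proof.
move=> [_ _ acyclic] x y /= eq_add.
have cycle_x : iter 2 (fun z => p z - (p x - y))%R x = x.
  rewrite /= subKr; have -> : (p y - (p x - y) = y + p y - p x)%R by ring.
  by rewrite -eq_add addrK.
by rewrite -(acyclic (p x - y)%R x 2 isT cycle_x) subKr.
Qed.

Definition boxcount (p : z25 -> z25) (k : z25) : nat := #|[set x | zbox x (p x) == k]|.

Definition movex (u tx : z25) (sw : bool) (c : z25 * z25) : z25 :=
  zadd (zmul u (if sw then c.2 else c.1)) tx.
Definition movey (u ty : z25) (sw : bool) (c : z25 * z25) : z25 :=
  zadd (zmul u (if sw then c.1 else c.2)) ty.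
Definition move_box (u tx ty : z25) (sw : bool) (k : z25) : z25 :=
  zbox (movex u tx sw (box_corner k)) (movey u ty sw (box_corner k)).

Lemma affine_inj (u t : z25) : zunit u -> injective (fun x : z25 => u * x + t)%R.
Proof. by move=> u_unit x y /addIr; apply: mulrI. Qed.

Lemma eq_res_affine (u t x y : z25) : zunit u ->
  (res (u * x + t)%R == res (u * y + t)%R) = (res x == res y).
Proof.
move=> u_unit; rewrite !res_add eqn_modDr !(modn_small (res_lt _)).
apply: (elimT eqP); move: u_unit; apply/implyP; by_inspection.
Qed.

Lemma zbox_move u tx ty sw x y :
  zbox (movex u tx sw (x, y)) (movey u ty sw (x, y)) = move_box u tx ty sw (zbox x y).
Proof.
have res_affine (t a b : z25) : res a = res b -> res (u * a + t)%R = res (u * b + t)%R.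
  by rewrite !res_add !res_mul => ->.
apply/eqP; rewrite zbox_eqE.
by apply/andP; split; apply/eqP; case: sw; apply: res_affine;
   rewrite /= ?quo_zbox ?res_zbox res_of_nat modn_small ?res_lt.
Qed.

Lemma move_box_inj u tx ty sw : zunit u -> injective (move_box u tx ty sw).
Proof.
move=> u_unit k l /eqP.
rewrite -(zbox_corner k) -(zbox_corner l); case: (box_corner k) (box_corner l) => [x y] [x' y'] /=.
rewrite -!zbox_move zbox_eqE => /andP[eq_x eq_y]; apply/eqP; rewrite zbox_eqE.
by case: sw eq_x eq_y; rewrite !eq_res_affine // => -> ->.
Qed.

Lemma queens_affine p q (u tx ty : z25) : zunit u ->
  (forall x, p (u * x + tx)%R = (u * q x + ty)%R) -> acyclic_queens p -> acyclic_queens q.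
Proof.
move=> u_unit pE [p_inj sub_inj acyclic]; have u_inj t := affine_inj (t := t) u_unit.
split.
- by move=> x y eq_q; apply: (u_inj tx); apply: p_inj; rewrite !pE eq_q.
- move=> x y /= eq_q; apply: (u_inj tx); apply: sub_inj; rewrite !pE.
  have -> a b : (u * a + ty - (u * b + tx) = u * (a - b) + (ty - tx))%R by ring.
  by rewrite eq_q; ring.
move=> i x m m_bounds cycle_q; pose phi x := (u * x + tx)%R; pose j := (u * i + ty - tx)%R.
have conj z : (p (phi z) - j)%R = phi (q z - i)%R by rewrite pE /phi /j; ring.
have conj_iter n z : iter n (fun z => p z - j)%R (phi z) = phi (iter n (fun z => q z - i)%R z).
  by elim: n => //= n ->; rewrite conj.
apply: (u_inj tx); rewrite -[LHS]/(phi _) -conj.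
by apply: (acyclic _ _ m) => //; rewrite conj_iter cycle_q.
Qed.

Lemma queens_inverse p q : cancel p q -> cancel q p -> acyclic_queens p -> acyclic_queens q.
Proof.
move=> pK qK [p_inj sub_inj acyclic]; split; first exact: can_inj qK.
- move=> x y /= eq_q; apply: (can_inj qK); apply: sub_inj; rewrite !qK.
  by rewrite -opprB eq_q opprB.
move=> i x m m_bounds; set f := fun z => _ => cycle_q; pose g z := p (z + i)%R.
have fK : cancel f g by move=> z; rewrite /g /f subrK qK.
have iter_fK n z : iter n g (iter n f z) = z.
  by elim: n z => // n IHn z; rewrite iterSr [iter n.+1 f z]iterS fK IHn.
have conj n z : iter n (fun z => p z - - i)%R (z + i)%R = (iter n g z + i)%R.
  by elim: n => //= n ->; rewrite opprK.
have cycle_g : iter m g x = x by rewrite -[in LHS]cycle_q iter_fK.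
have /addIr gx : (g x + i = x + i)%R.
  by rewrite -[RHS](acyclic (- i)%R (x + i)%R m) ?conj ?cycle_g // opprK.
by rewrite -[in LHS]gx -/(f _) /f /g pK addrK.
Qed.

Lemma queens_move p (u tx ty : z25) sw : zunit u -> acyclic_queens p ->
  exists q, [/\ acyclic_queens q,
    forall k, boxcount q k = boxcount p (move_box u tx ty sw k) &
    forall c, (q c.1 == c.2) = (p (movex u tx sw c) == movey u ty sw c)].
Proof.
move=> u_unit queens_p.
suff [q queens_q qE] : exists2 q, acyclic_queens q &
    forall c, (q c.1 == c.2) = (p (movex u tx sw c) == movey u ty sw c).
  exists q; split=> // k; rewrite /boxcount.
  have g_inj : injective (fun x => movex u tx sw (x, q x)).
    by move=> x y /(affine_inj u_unit); case: (sw) => //; apply: queens_inj.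
  rewrite -[RHS](card_preimset _ g_inj); apply: eq_card => x; rewrite !inE.
  have /eqP-> : p (movex u tx sw (x, q x)) == movey u ty sw (x, q x) by rewrite -qE.
  by rewrite zbox_move (inj_eq (move_box_inj u_unit)).
pose r x := (u^-1 * (p (u * x + tx) - ty))%R.
have pE x : p (u * x + tx)%R = (u * r x + ty)%R by rewrite mulVKr // subrK.
have queens_r := queens_affine u_unit pE queens_p.
have rE x y : (r x == y) = (p (u * x + tx)%R == (u * y + ty)%R).
  by rewrite pE (inj_eq (affine_inj u_unit)).
case: sw; last by exists r => // c; rewrite rE.
have r_inj := queens_inj queens_r; exists (invF r_inj).
  exact: queens_inverse (invF_f r_inj) (f_invF r_inj) queens_r.
by move=> c; rewrite -rE (can2_eq (f_invF r_inj) (invF_f r_inj)) eq_sym.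
Qed.

(** * Box types *)

Definition box_type : Type := seq nat.

Definition box_types : seq box_type := [::
  [:: 1;1;1;1;1; 1;1;1;1;1; 1;1;1;1;1; 1;1;1;1;1; 1;1;1;1;1];
  [:: 0;1;1;1;2; 1;1;1;1;1; 2;1;1;1;0; 1;0;1;2;1; 1;2;1;0;1];
  [:: 0;1;1;1;2; 1;1;2;0;1; 2;0;1;1;1; 1;1;1;2;0; 1;2;0;1;1];
  [:: 0;0;1;2;2; 1;2;1;0;1; 1;1;1;1;1; 1;0;1;2;1; 2;2;1;0;0];
  [:: 0;0;2;1;2; 1;2;1;0;1; 1;1;0;2;1; 1;1;1;2;0; 2;1;1;0;1];
  [:: 0;0;1;2;2; 1;3;1;0;0; 1;0;0;2;2; 1;1;2;1;0; 2;1;1;0;1];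
  [:: 0;0;1;1;3; 1;2;1;0;1; 1;1;1;2;0; 2;0;0;2;1; 1;2;2;0;0];
  [:: 0;0;1;1;3; 1;1;2;0;1; 2;1;1;1;0; 1;0;0;3;1; 1;3;1;0;0];
  [:: 0;0;2;1;2; 1;2;0;0;2; 0;2;1;2;0; 2;0;0;2;1; 2;1;2;0;0];
  [:: 0;0;1;2;2; 1;2;2;0;0; 2;0;0;1;2; 0;1;2;2;0; 2;2;0;0;1];
  [:: 0;0;0;2;3; 1;2;2;0;0; 2;0;1;1;1; 1;0;1;2;1; 1;3;1;0;0];
  [:: 0;0;1;1;3; 0;2;2;0;1; 2;1;0;1;1; 1;0;1;3;0; 2;2;1;0;0];
  [:: 0;0;1;3;1; 1;3;1;0;0; 1;0;0;1;3; 0;1;3;1;0; 3;1;0;0;1];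
  [:: 0;0;1;1;3; 1;1;3;0;0; 3;0;0;1;1; 0;1;1;3;0; 1;3;0;0;1];
  [:: 0;0;0;2;3; 0;3;2;0;0; 2;0;0;1;2; 1;0;2;2;0; 2;2;1;0;0];
  [:: 0;0;0;2;3; 0;2;3;0;0; 3;0;0;0;2; 0;0;2;3;0; 2;3;0;0;0];
  [:: 0;0;0;1;4; 0;1;4;0;0; 4;0;0;0;1; 0;0;1;4;0; 1;4;0;0;0];
  [:: 0;0;0;1;4; 0;4;1;0;0; 1;0;0;3;1; 3;0;1;1;0; 1;1;3;0;0];
  [:: 0;0;0;1;4; 0;3;2;0;0; 2;0;0;2;1; 2;0;1;2;0; 1;2;2;0;0];
  [:: 0;0;0;1;4; 0;2;3;0;0; 3;0;0;1;1; 1;0;1;3;0; 1;3;1;0;0];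
  [:: 0;0;0;0;5; 0;2;3;0;0; 3;0;0;2;0; 2;0;0;3;0; 0;3;2;0;0];
  [:: 0;0;0;0;5; 0;1;4;0;0; 4;0;0;1;0; 1;0;0;4;0; 0;4;1;0;0];
  [:: 0;0;0;0;5; 0;0;5;0;0; 5;0;0;0;0; 0;0;0;5;0; 0;5;0;0;0]].

Definition has_type (t : box_type) (p : z25 -> z25) : Prop := forall k : z25, boxcount p k = nth 0 t k.

Lemma sum_z25 (P : pred z25) (F : z25 -> nat) :
  \sum_(k | P k) F k = sumn [seq F k | k <- z25s & P k].
Proof.
rewrite sumnE big_map big_filter; apply: perm_big; apply: uniq_perm => [||k] //.
  exact: index_enum_uniq.
by rewrite mem_index_enum mem_z25s.
Qed.

Lemma card_z25 (P : pred z25) : #|[set k | P k]| = count P z25s.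
Proof.
rewrite -sum1_card -size_filter -[size _](size_map (fun=> 1)) -sum1_size.
rewrite (eq_bigl P) => [|k]; last by rewrite inE.
by rewrite sum_z25 sumnE !big_map.
Qed.

Lemma sum_boxcount p (g : z25 -> z25) (cls : pred z25) r : injective g -> r < 5 ->
  (forall x, cls (zbox x (p x)) = (res (g x) == r)) -> \sum_(k | cls k) boxcount p k = 5.
Proof.
move=> g_inj r_lt clsE.
transitivity #|g @^-1: [set z | res z == r]|; last first.
  by rewrite card_preimset // card_z25; case: r r_lt clsE => [|[|[|[|[|]]]]].
rewrite -sum1_card [RHS](partition_big (fun x => zbox x (p x)) cls) => [|x]; last by rewrite !inE clsE.
apply: eq_bigr => k cls_k; rewrite /boxcount -sum1_card; apply: eq_bigl => x.
by rewrite !inE -clsE; case: eqP => [->|]; rewrite ?andbF ?cls_k.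
Qed.

Record balanced (N : z25 -> nat) : Prop := Balanced {
  sum_row : forall r, r < 5 -> \sum_(k | quo k == r) N k = 5;
  sum_col : forall r, r < 5 -> \sum_(k | res k == r) N k = 5;
  sum_diag : forall r, r < 5 -> \sum_(k | (res k + 5 - quo k) %% 5 == r) N k = 5;
  sum_anti : forall r, r < 5 -> \sum_(k | (quo k + res k) %% 5 == r) N k = 5 }.

Lemma boxcount_balanced p : acyclic_queens p -> balanced (boxcount p).
Proof.
move=> queens_p; have add_inj := queens_add_inj queens_p; case: queens_p => p_inj sub_inj _.
split=> r r_lt.
- by apply: (sum_boxcount (g := id) (r := r)) => // x; rewrite quo_zbox.
- by apply: (sum_boxcount p_inj (r := r)) => // x; rewrite res_zbox.
- apply: (sum_boxcount sub_inj (r := r)) => // x; rewrite quo_zbox res_zbox; congr (_ == r).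
  by move: (p x) => y; by_inspection.
apply: (sum_boxcount add_inj (r := r)) => // x; rewrite quo_zbox res_zbox; congr (_ == r).
by move: (p x) => y; by_inspection.
Qed.

Lemma balanced_gt0 N : balanced N -> (forall k, 0 < N k) -> forall k, N k = 1.
Proof.
move=> N_bal N_gt0 k.
have le1N j : quo j == quo k -> 1 <= N j ?= iff (1 == N j) by move=> _; apply: leqif_eq.
have [_] := leqif_sum le1N; rewrite (sum_row N_bal) ?quo_lt // sum_z25.
have -> : sumn [seq 1 | j <- z25s & quo j == quo k] = 5 by case: k {le1N}.
by rewrite eqxx => /esym/forall_inP/(_ k (eqxx _))/eqP.
Qed.

(* The balanced functions vanishing on box [0] are the sums of a function of [b - 2 a] and a function of
   [b + 2 a] that vanish at [0], where [a] and [b] are the coordinates of the box; [v] lists the other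
   values of the two functions. *)
Definition balanced_of (v : seq nat) : box_type :=
  [seq nth 0 (0 :: take 4 v) ((res k + 10 - 2 * quo k) %% 5) +
       nth 0 (0 :: drop 4 v) ((res k + 2 * quo k) %% 5) | k <- z25s].

Ltac sum_over_line eq :=
  have := eq isT; rewrite sum_z25;
  match goal with |- context [filter ?P z25s] =>
    let line := eval vm_compute in (filter P z25s) in change (filter P z25s) with line
  end; rewrite /=.
Ltac sums_over_lines eqs :=
  sum_over_line (eqs 0); sum_over_line (eqs 1); sum_over_line (eqs 2); sum_over_line (eqs 3);
  sum_over_line (eqs 4).

Lemma balanced_vanishing N : balanced N -> N z0 = 0 ->
  exists v, [/\ size v = 8, sumn v = 5 & [seq N k | k <- z25s] = balanced_of v].
Proof.
move=> [row col diag anti] N0.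
sums_over_lines row; sums_over_lines col; sums_over_lines diag; sums_over_lines anti.
exists [:: N z8; N z11; N z19; N z22; N z23; N z16; N z14; N z7].
rewrite /balanced_of /= N0; split=> //; first lia.
by do ![apply: (congr2 cons); first lia].
Qed.

Definition infeasible (t : box_type) : Prop := forall p, acyclic_queens p -> ~ has_type t p.

Definition move_type (u tx ty : z25) (sw : bool) (t : box_type) : box_type :=
  [seq nth 0 t (move_box u tx ty sw k) | k <- z25s].

Lemma nth_z25s (f : z25 -> nat) (k : z25) : nth 0 [seq f j | j <- z25s] k = f k. Proof. by case: k. Qed.

Lemma move_boxK (u tx ty : z25) sw : zunit u ->
  cancel (move_box u^-1 (- u^-1 * (if sw then ty else tx)) (- u^-1 * (if sw then tx else ty)) sw)%R
    (move_box u tx ty sw).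
Proof.
move=> u_unit k; rewrite [X in move_box _ _ _ _ X]/move_box -zbox_move -[RHS]zbox_corner.
have cancel_affine (t a : z25) : (u * (u^-1 * a + - u^-1 * t) + t = a)%R.
  by rewrite mulNr -mulrBr mulVKr // subrK.
by case: sw; congr zbox; apply: cancel_affine.
Qed.

Lemma infeasible_move (u tx ty : z25) sw t : zunit u -> infeasible t -> infeasible (move_type u tx ty sw t).
Proof.
move=> u_unit t_inf p queens_p type_p.
have uV_unit : zunit u^-1%R := etrans (unitrV u) u_unit.
have [q [queens_q countE _]] := queens_move
  (- u^-1 * (if sw then ty else tx))%R (- u^-1 * (if sw then tx else ty))%R sw uV_unit queens_p.
by apply: (t_inf q queens_q) => k; rewrite countE type_p nth_z25s move_boxK.
Qed.

Fixpoint compositions (n m : nat) : seq (seq nat) :=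
  if n is n'.+1 then [seq a :: s | a <- iota 0 m.+1, s <- compositions n' (m - a)]
  else if m == 0 then [:: [::]] else [::].

Lemma mem_compositions s : s \in compositions (size s) (sumn s).
Proof.
elim: s => // a s IHs; apply: allpairs_f_dep; first by rewrite mem_iota /=; lia.
by rewrite -[sumn (a :: s)]/(a + sumn s) addKn.
Qed.

Definition moves : seq (z25 * z25 * z25 * bool) :=
  let reps := take 5 z25s in
  [seq (g, sw) | g <- [seq (h, ty) | h <- [seq (u, tx) | u <- behead reps, tx <- reps], ty <- reps],
                 sw <- [:: false; true]].

Lemma moves_unit g : g \in moves -> zunit g.1.1.1.
Proof. by apply/allP: g. Qed.

Definition moved_types : seq box_type :=
  [seq t <- [seq move_type g.1.1.1 g.1.1.2 g.1.2 g.2 t | t <- box_types, g <- moves] | nth 0 t 0 == 0].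

(* Short-circuiting versions of [==] and [\in]: [vm_compute] evaluates both arguments of [&&] and [||]. *)
Fixpoint eqseq_lazy (s t : seq nat) : bool :=
  match s, t with
  | [::], [::] => true
  | a :: s', b :: t' => if a == b then eqseq_lazy s' t' else false
  | _, _ => false
  end.
Fixpoint mem_lazy (s : seq nat) (l : seq (seq nat)) : bool :=
  if l is t :: l' then if eqseq_lazy s t then true else mem_lazy s l' else false.

Lemma mem_lazyE s l : mem_lazy s l = (s \in l).
Proof.
have eqE t : eqseq_lazy s t = (s == t).
  by elim: s t => [|a s IHs] [|b t] //=; rewrite IHs.
by elim: l => //= t l ->; rewrite inE eqE.
Qed.

Lemma balanced_of_moved_types :
  let l := moved_types in all (fun v => mem_lazy (balanced_of v) l) (compositions 8 5).
Proof. by vm_compute. Qed.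

Lemma no_acyclic_queens p : (forall t, t \in box_types -> infeasible t) -> ~ acyclic_queens p.
Proof.
move=> box_types_inf queens_p.
have [/forallP/= count_gt0|] := boolP [forall k, 0 < boxcount p k].
  apply: (box_types_inf (nth [::] box_types 0) (mem_nth _ _) p queens_p) => // k.
  by rewrite (balanced_gt0 (boxcount_balanced queens_p) count_gt0); case: k.
rewrite negb_forall => /existsP[k]; rewrite -eqn0Ngt => /eqP count0.
have [q [queens_q countE _]] :=
  queens_move (box_corner k).1 (box_corner k).2 false (isT : zunit z1) queens_p.
have q0 : boxcount q z0 = 0 by rewrite countE -[RHS]count0; congr boxcount; case: (k).
have [v [size_v sum_v countsE]] := balanced_vanishing (boxcount_balanced queens_q) q0.
have := mem_compositions v; rewrite size_v sum_v => /(allP balanced_of_moved_types).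
rewrite mem_lazyE mem_filter => /andP[_] /allpairsP[[t g] [/= t_in g_in moved_t]].
have type_q : has_type [seq boxcount q k | k <- z25s] q by move=> j; rewrite nth_z25s.
rewrite countsE moved_t in type_q.
exact: (infeasible_move (moves_unit g_in) (box_types_inf t t_in) queens_q type_q).
Qed.

Definition pattern : Type := seq (z25 * z25).
Definition contains (p : z25 -> z25) (pat : pattern) : bool := all (fun c => p c.1 == c.2) pat.
Definition refuted (t : box_type) (pat : pattern) : Prop :=
  forall p, acyclic_queens p -> has_type t p -> ~ contains p pat.

(* Translations by multiples of 5 preserve every box, so a queen of a nonempty box can be moved to any given
   cell of this box. *)
Lemma infeasible_of_cell t x y : 0 < nth 0 t (zbox x y) -> refuted t [:: (x, y)] -> infeasible t.
Proof.
move=> count_gt0 ref p queens_p type_p; move: count_gt0; rewrite -type_p card_gt0 => /set0Pn[a].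
rewrite inE zbox_eqE => /andP[res_a res_pa].
have [q [queens_q countE qE]] :=
  queens_move (a - x)%R (p a - y)%R false (isT : zunit z1) queens_p.
have translate (b c : z25) : zadd (zmul z1 c) (b - c)%R = b.
  by rewrite -[LHS]/(1 * c + (b - c))%R mul1r addrC subrK.
apply: (ref q queens_q) => [k|]; last first.
  by rewrite /contains /= andbT (qE (x, y)) /movex /movey !translate.
rewrite countE type_p; congr (nth 0 t (nat_of_z25 _)).
have fix_box (b b' c : z25) : res b == res b' -> res (zadd (zmul z1 c) (b - b')%R) == res c.
  by apply/implyP; by_inspection.
by rewrite -[RHS]zbox_corner; apply/eqP; rewrite zbox_eqE !fix_box.
Qed.

(** * Sets of residues *)

Inductive quint (A : Type) : Type := Quint (a b c d e : A).
Arguments Quint {A}.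

Definition sel (A : Type) (j : nat) (m : quint A) : A :=
  let: Quint a b c d e := m in
  match j with 0 => a | 1 => b | 2 => c | 3 => d | _ => e end.
Definition upd (A : Type) (j : nat) (f : A -> A) (m : quint A) : quint A :=
  let: Quint a b c d e := m in
  match j with
  | 0 => Quint (f a) b c d e | 1 => Quint a (f b) c d e | 2 => Quint a b (f c) d e
  | 3 => Quint a b c (f d) e | _ => Quint a b c d (f e)
  end.
Definition quint_of (A : Type) (f : nat -> A) : quint A := Quint (f 0) (f 1) (f 2) (f 3) (f 4).

Lemma sel_upd A i j (f : A -> A) m : i < 5 -> j < 5 ->
  sel i (upd j f m) = if i == j then f (sel i m) else sel i m.
Proof. by case: m; case: i => [|[|[|[|[|]]]]] //; case: j => [|[|[|[|[|]]]]]. Qed.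

Lemma sel_quint_of A (f : nat -> A) i : i < 5 -> sel i (quint_of f) = f i.
Proof. by case: i => [|[|[|[|[|]]]]]. Qed.

(* A function on [z25]; the value at [5 i + j] is entry [j] of row [i]. *)
Definition arr (A : Type) : Type := quint (quint A).
Definition aget (A : Type) : arr A -> z25 -> A := Eval cbv in
  fun (m : arr A) (z : z25) => tab25 (fun z => sel (res z) (sel (quo z) m)) z.
Definition amod (A : Type) : (A -> A) -> arr A -> z25 -> arr A := Eval cbv in
  fun (f : A -> A) (m : arr A) (z : z25) => let: Quint a b c d e := m in
  tab25 (fun z => upd (quo z) (upd (res z) f) (Quint a b c d e)) z.
Definition amake (A : Type) (f : z25 -> A) : arr A :=
  quint_of (fun i => quint_of (fun j => f (z25_of_nat (5 * i + j)))).

Lemma aget_amod A (f : A -> A) (m : arr A) z t :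
  aget (amod f m z) t = if t == z then f (aget m t) else aget m t.
Proof.
case: m => -[? ? ? ? ?] [? ? ? ? ?] [? ? ? ? ?] [? ? ? ? ?] [? ? ? ? ?].
by rewrite -zeqE; case: z; case: t.
Qed.

Definition rsel (A : Type) : z25 -> quint A -> A := Eval cbv in
  fun (z : z25) (m : quint A) => let: Quint a b c d e := m in
  tab25 (fun z => sel (res z) (Quint a b c d e)) z.
Lemma rselE A z (m : quint A) : rsel z m = sel (res z) m. Proof. by case: m => *; case: z. Qed.

Lemma aget_amake A (f : z25 -> A) t : aget (amake f) t = f t. Proof. by case: t. Qed.

(* A digit is a set of numbers smaller than 5, given by its binary expansion. *)
Inductive digit : Set :=
  d0 | d1 | d2 | d3 | d4 | d5 | d6 | d7 | d8 | d9 | d10 | d11 | d12 | d13 |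
  d14 | d15 | d16 | d17 | d18 | d19 | d20 | d21 | d22 | d23 | d24 | d25 |
  d26 | d27 | d28 | d29 | d30 | d31.

Definition digits : seq digit :=
  [:: d0; d1; d2; d3; d4; d5; d6; d7; d8; d9; d10; d11; d12; d13; d14; d15; d16;
  d17; d18; d19; d20; d21; d22; d23; d24; d25; d26; d27; d28; d29; d30; d31].

Definition nat_of_digit (d : digit) : nat :=
  match d with
  | d0 => 0 | d1 => 1 | d2 => 2 | d3 => 3 | d4 => 4 | d5 => 5 | d6 => 6
  | d7 => 7 | d8 => 8 | d9 => 9 | d10 => 10 | d11 => 11 | d12 => 12
  | d13 => 13 | d14 => 14 | d15 => 15 | d16 => 16 | d17 => 17 | d18 => 18
  | d19 => 19 | d20 => 20 | d21 => 21 | d22 => 22 | d23 => 23 | d24 => 24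
  | d25 => 25 | d26 => 26 | d27 => 27 | d28 => 28 | d29 => 29 | d30 => 30
  | d31 => 31
  end.
Definition digit_of_nat (n : nat) : digit := nth d0 digits n.

Lemma nat_of_digitK : cancel nat_of_digit digit_of_nat. Proof. by case. Qed.

HB.instance Definition _ := Countable.copy digit (can_type nat_of_digitK).

Lemma mem_digits d : d \in digits. Proof. by case: d; vm_compute. Qed.

Definition bit (u : nat) (d : digit) : bool := odd (nat_of_digit d %/ 2 ^ u).
Definition digit_of_bits (f : pred nat) : digit :=
  digit_of_nat (foldr (fun u n => f u * 2 ^ u + n) 0 (iota 0 5)).

Lemma bit_of_bits f u : u < 5 -> bit u (digit_of_bits f) = f u.
Proof.
by case: u => [|[|[|[|[|]]]]] // _; rewrite /digit_of_bits /=;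
   case: (f 0); case: (f 1); case: (f 2); case: (f 3); case: (f 4).
Qed.

Definition tab32 (A : Type) (f : digit -> A) (d : digit) : A :=
  ltac:(pose fd := f d; destruct d; exact fd).

Definition digit_and : digit -> digit -> digit := Eval vm_compute in
  fun a b => tab32 (fun a => tab32 (fun b => digit_of_bits (fun u => bit u a && bit u b)) b) a.

Lemma bit_and u a b : u < 5 -> bit u (digit_and a b) = bit u a && bit u b.
Proof.
move=> u_lt; rewrite -(bit_of_bits (fun u => bit u a && bit u b) u_lt); congr bit.
by case: a; case: b.
Qed.

Definition rotations : quint (digit -> digit) := Eval vm_compute in
  quint_of (fun p => tab32 (fun d => digit_of_bits (fun u => bit ((u + p) %% 5) d))).
Lemma bit_rotation p u d : p < 5 -> u < 5 -> bit u (sel p rotations d) = bit ((u + p) %% 5) d.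
Proof.
move=> p_lt u_lt; rewrite -(bit_of_bits (fun u => bit ((u + p) %% 5) d) u_lt); congr bit.
by case: p p_lt => [|[|[|[|[|]]]]] // _; case: d.
Qed.

(* A set of residues; the residue [5 u + j] is bit [u] of digit [j], so that a translation permutes the
   digits and rotates each of them. *)
Definition mask : Type := quint digit.
Definition full_mask : mask := Quint d31 d31 d31 d31 d31.
Definition no_mask : mask := Quint d0 d0 d0 d0 d0.

Definition mbit : z25 -> pred mask := Eval vm_compute in
  fun (z : z25) (m : mask) => let: Quint a b c d e := m in
  tab25 (fun z => tab32 (bit (quo z)) (sel (res z) (Quint a b c d e))) z.
Definition mclear : z25 -> mask -> mask := Eval vm_compute in
  fun (z : z25) (m : mask) => let: Quint a b c d e := m in
  tab25 (fun z =>
    upd (res z) (tab32 (fun d => digit_of_bits (fun u => (u != quo z) && bit u d))) (Quint a b c d e)) z.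
Definition mand (m m' : mask) : mask :=
  let: Quint a b c d e := m in let: Quint a' b' c' d' e' := m' in
  Quint (digit_and a a') (digit_and b b') (digit_and c c') (digit_and d d') (digit_and e e').
Definition mshift : z25 -> mask -> mask := Eval cbv in
  fun (h : z25) (m : mask) => let: Quint a b c d e := m in
  tab25 (fun h : z25 => quint_of (fun j =>
    sel ((quo h + (j + res h) %/ 5) %% 5) rotations (sel ((j + res h) %% 5) (Quint a b c d e)))) h.
Definition digitwise (f : z25 -> digit) : mask := Quint (f z0) (f z1) (f z2) (f z3) (f z4).

Lemma sel_digitwise f t : sel (res t) (digitwise f) = f (z25_of_nat (res t)). Proof. by case: t. Qed.

Lemma mbitE z m : mbit z m = bit (quo z) (sel (res z) m).
Proof.
case: m => a b c d e.
by case: z; first [by case: a | by case: b | by case: c | by case: d | by case: e].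
Qed.

Lemma mbit_full t : mbit t full_mask. Proof. by case: t. Qed.

Lemma mbit_clear z t m : mbit t (mclear z m) = (t != z) && mbit t m.
Proof.
have -> : mclear z m = upd (res z) (fun d => digit_of_bits (fun u => (u != quo z) && bit u d)) m.
  case: m => a b c d e; case: z; congr Quint;
    first [by case: a | by case: b | by case: c | by case: d | by case: e].
rewrite !mbitE sel_upd ?res_lt // z25_eqE; case: (res t == res z) => /=; last by rewrite andbF.
by rewrite bit_of_bits ?quo_lt // andbT.
Qed.

Lemma mbit_and t m m' : mbit t (mand m m') = mbit t m && mbit t m'.
Proof.
rewrite !mbitE; case: m m' => [? ? ? ? ?] [? ? ? ? ?]; move: (quo_lt t) (res_lt t).
by case: (res t) => [|[|[|[|[|]]]]] // u_lt _; apply: bit_and.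
Qed.

Lemma mbit_shift h t m : mbit t (mshift h m) = mbit (t + h)%R m.
Proof.
have -> : mshift h m = quint_of (fun j =>
    sel ((quo h + (j + res h) %/ 5) %% 5) rotations (sel ((j + res h) %% 5) m)).
  by case: m => *; case: h.
rewrite !mbitE sel_quint_of ?res_lt // bit_rotation ?ltn_pmod ?quo_lt // res_add modnDmr; congr (bit _ _).
by_inspection.
Qed.

Definition line_mask (k : z25) (m below above : mask) : mask :=
  mand m (mand (mshift (zopp k) below) (mshift k above)).
Lemma mbit_line_mask t k m below above :
  mbit t (line_mask k m below above) = [&& mbit t m, mbit (t - k)%R below & mbit (t + k)%R above].
Proof. by rewrite !mbit_and !mbit_shift. Qed.

Definition push_digits : quint (digit -> seq z25 -> seq z25) := Eval vm_compute in
  quint_of (fun j d (l : seq z25) =>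
  tab32 (fun d => foldr (fun u l => if bit u d then z25_of_nat (5 * u + j) :: l else l) l (iota 0 5)) d).
Definition elements (m : mask) : seq z25 :=
  let: Quint a b c d e := m in
  sel 0 push_digits a (sel 1 push_digits b (sel 2 push_digits c (sel 3 push_digits d
    (sel 4 push_digits e [::])))).

Lemma mem_push_digits j d l t : j < 5 ->
  (t \in sel j push_digits d l) = (res t == j) && bit (quo t) d || (t \in l).
Proof.
move=> j_lt; have -> : sel j push_digits d l = sel j push_digits d [::] ++ l.
  by case: j j_lt => [|[|[|[|[|]]]]] // _; case: d.
rewrite mem_cat; congr (_ || _).
have: all (fun j => all (fun d => all (fun t =>
  (t \in sel j push_digits d [::]) == (res t == j) && bit (quo t) d) z25s) digits) (iota 0 5).
  by vm_compute.
move/allP/(_ j); rewrite mem_iota => /(_ j_lt) /allP/(_ d (mem_digits d)).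
by move/allP/(_ t (mem_z25s t))/eqP.
Qed.

Lemma mem_elements t m : (t \in elements m) = mbit t m.
Proof.
case: m => a b c d e; rewrite mbitE /elements !mem_push_digits // orbF.
by have := res_lt t; case: (res t) => [|[|[|[|[|]]]]] //; rewrite ?orbF.
Qed.

(** * The checker *)

(* The lines that contain exactly one queen, and the boxes. *)
Inductive dir : Set := Row | Col | Diag | Anti | Box.

Definition zhalf_sub : z25 -> z25 -> z25 := Eval vm_compute in
  tab25_2 (fun a b => zmul (z25_of_nat 13) (zsub a b)).
Definition zhalf_add : z25 -> z25 -> z25 := Eval vm_compute in
  tab25_2 (fun a b => zmul (z25_of_nat 13) (zadd a b)).
Definition box_x : z25 -> z25 -> z25 := Eval vm_compute in
  tab25_2 (fun k t => z25_of_nat (quo k + 5 * res t)).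
Definition box_y : z25 -> z25 -> z25 := Eval vm_compute in
  tab25_2 (fun k t => z25_of_nat (res k + 5 * quo t)).
Definition box_slot : z25 -> z25 -> z25 := Eval vm_compute in
  tab25_2 (fun x y => z25_of_nat (quo x + 5 * quo y)).

(* The cell [(x, y)] is at position [slot_of v x y] of line number [line_of v x y] in direction [v];
   [cellx] and [celly] recover its coordinates. *)
Definition line_of (v : dir) (x y : z25) : z25 :=
  match v with Row => x | Col => y | Diag => zsub y x | Anti => zadd x y | Box => zbox x y end.
Definition slot_of (v : dir) (x y : z25) : z25 :=
  match v with Row => y | Col => x | Diag => zadd x y | Anti => zsub y x | Box => box_slot x y end.
Definition cellx (v : dir) (k t : z25) : z25 :=
  match v with
  | Row => k | Col => t | Diag => zhalf_sub t k | Anti => zhalf_sub k t | Box => box_x k t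
  end.
Definition celly (v : dir) (k t : z25) : z25 :=
  match v with
  | Row => t | Col => k | Diag => zhalf_add t k | Anti => zhalf_add t k | Box => box_y k t
  end.

Lemma cellxK v x y : cellx v (line_of v x y) (slot_of v x y) = x.
Proof. by case: v => //=; by_inspection. Qed.

Lemma cellyK v x y : celly v (line_of v x y) (slot_of v x y) = y.
Proof. by case: v => //=; by_inspection. Qed.

(* What remains free when the queens of a partial solution are placed: rows [x], columns [y], differences
   [y - x], sums [x + y], and the values of [x - y], [2 x], [2 y] and [- 2 x]; then the column of the queen
   of every row and the number of queens still missing in every box. *)
Record state : Type := State {
  rows : mask; cols : mask; diffs : mask; sums : mask;
  codiffs : mask; dbl_rows : mask; dbl_cols : mask; opp_dbl_rows : mask;
  placed : arr (option z25); room : arr nat }.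

Definition place (s : state) (x y : z25) : state :=
  let: State mx my md ms me m2x m2y mn2x f r := s in
  State (mclear x mx) (mclear y my) (mclear (zsub y x) md) (mclear (zadd x y) ms)
    (mclear (zsub x y) me) (mclear (zadd x x) m2x) (mclear (zadd y y) m2y)
    (mclear (zopp (zadd x x)) mn2x) (amod (fun=> Some y) f x) (amod predn r (zbox x y)).

Definition has_room (r : arr nat) (k : z25) : bool := if aget r k is 0 then false else true.

Definition open_line (s : state) (v : dir) (k : z25) : bool :=
  match v with
  | Row => mbit k (rows s) | Col => mbit k (cols s) | Diag => mbit k (diffs s)
  | Anti => mbit k (sums s) | Box => has_room (room s) k
  end.

(* In every direction but [Box], the cell at position [t] of line [k] is attacked through [t], [t - k] and
   [t + k] only. *)
Definition unattacked (s : state) (v : dir) (k : z25) : mask :=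
  let: State mx my md ms me m2x m2y mn2x _ _ := s in
  match v with
  | Row => line_mask k my md ms
  | Col => line_mask k mx me ms
  | Diag => line_mask k ms m2x m2y
  | Anti => line_mask k md mn2x m2y
  | Box =>
    digitwise (fun t => let x := box_x k t in if mbit x mx then rsel k (line_mask x my md ms) else d0)
  end.
(* Whether the queens [f] send [a] to [x] by at most [n] iterations of [z => f z - i], and at least one. *)
Fixpoint closes (n : nat) (f : arr (option z25)) (i x a : z25) : bool :=
  if n is n'.+1 then
    if aget f a is Some b then
      let c := zsub b i in if zeq c x then true else closes n' f i x c
    else false
  else false.

Definition preserves (t : box_type) (u tx ty : z25) (sw : bool) : bool :=
  zunit u && all (fun k : z25 => nth 0 t (move_box u tx ty sw k) == nth 0 t k) z25s.
Definition symmetries (t : box_type) : arr (quint (bool * bool)) :=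
  let rep := z25_of_nat in
  quint_of (fun a => quint_of (fun b => quint_of (fun u =>
    (preserves t (rep u) (rep a) (rep b) false, preserves t (rep u) (rep a) (rep b) true)))).
Definition is_symmetry (st : arr (quint (bool * bool))) (u tx ty : z25) (sw : bool) : bool :=
  let: (b, b_sw) := rsel u (rsel ty (rsel tx st)) in if sw then b_sw else b.

Definition occupied (f : arr (option z25)) (x y a b : z25) : bool :=
  if zeq a x then zeq b y else if aget f a is Some c then zeq c b else false.
Fixpoint all_occupied (f : arr (option z25)) (x y u tx ty : z25) (sw : bool) (pat : pattern) : bool :=
  if pat is c :: pat' then
    if occupied f x y (movex u tx sw c) (movey u ty sw c) then all_occupied f x y u tx ty sw pat'
    else false
  else true.

Definition tab256 (A : Type) (f : byte -> A) (b : byte) : A :=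
  ltac:(pose fb := f b; destruct b; exact fb).

(* Why a cell of a box with room left cannot receive a queen: by a case analysis on a line once the queen is
   there, because it closes a short cycle of [z => p z - i], or because some image of a refuted pattern is
   then occupied. The byte after [Image] tells which cell of which pattern is sent to this cell, as an index in
   [anchors]. *)
Inductive action : Set := Split (v : dir) (k : z25) | Cycle (i : z25) | Image (u : z25) (sw : bool).

Definition units : seq z25 := [seq u <- z25s | zunit u].
Definition decode : byte -> action := Eval vm_compute in tab256 (fun b =>
  let n := Byte.to_nat b in
  let z := z25_of_nat n in
  match n %/ 25 with
  | 0 => Split Row z | 1 => Split Col z | 2 => Split Diag z | 3 => Split Anti z | 4 => Split Box z
  | 5 => Cycle z
  | _ => Image (nth z1 units ((n - 150) %/ 2)) (odd n)
  end).

Definition anchors (known : seq pattern) : seq (z25 * z25 * pattern) :=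
  [seq (c, pat) | pat <- known, c <- pat].

Section Checker.
Variables (st : arr (quint (bool * bool))) (anchored : seq (z25 * z25 * pattern)).

Definition occupied_image (f : arr (option z25)) (x y u : z25) (sw : bool) (j : byte) : bool :=
  if onth anchored (Byte.to_nat j) is Some (c, pat) then
    let tx := zsub x (movex u z0 sw c) in let ty := zsub y (movey u z0 sw c) in
    if is_symmetry st u tx ty sw then all_occupied f x y u tx ty sw pat else false
  else false.

Fixpoint check (n : nat) (s : state) (v : dir) (k : z25) (l : seq byte) : option (seq byte) :=
  if n is n'.+1 then
    if open_line s v k then
      (fix check_cells (ts : seq z25) (l : seq byte) : option (seq byte) :=
        if ts is t :: ts' then
          let x := cellx v k t in let y := celly v k t in
          if aget (room s) (zbox x y) is 0 then check_cells ts' l else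
          if l is b :: l then
            if match decode b with
               | Split v k => check n' (place s x y) v k l
               | Cycle i => if closes 6 (placed s) i x (zsub y i) then Some l else None
               | Image u sw =>
                 if l is j :: l then
                   if occupied_image (placed s) x y u sw j then Some l else None
                 else None
               end is Some l then check_cells ts' l
            else None
          else None
        else Some l) (elements (unattacked s v k)) l
    else None
  else None.
End Checker.

Lemma is_symmetryE t u tx ty sw : is_symmetry (symmetries t) u tx ty sw = preserves t u tx ty sw.
Proof.
have -> : preserves t u tx ty sw = preserves t (z25_of_nat (res u)) (z25_of_nat (res tx))
    (z25_of_nat (res ty)) sw.
  rewrite /preserves; congr (_ && _); first by case: u.
  apply: eq_all => k; congr (nth 0 t (nat_of_z25 _) == _); apply/eqP.
  rewrite zbox_eqE !res_add !res_mul.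
  by rewrite ![res (z25_of_nat (res _))]res_of_nat !(modn_small (res_lt _)) !eqxx.
by rewrite /is_symmetry !rselE /symmetries !sel_quint_of ?res_lt //; case: sw.
Qed.

Definition free_cell (s : state) (x y : z25) : bool :=
  [&& mbit x (rows s), mbit y (cols s), mbit (y - x) (diffs s), mbit (x + y) (sums s),
      mbit (x - y) (codiffs s), mbit (x + x) (dbl_rows s), mbit (y + y) (dbl_cols s) &
      mbit (- (x + x)) (opp_dbl_rows s)]%R.

Lemma unattacked_free s v x y :
  free_cell s x y -> mbit (slot_of v x y) (unattacked s v (line_of v x y)).
Proof.
case: s => mx my md ms me m2x m2y mn2x f r; rewrite /free_cell /=.
case/and5P=> xm ym dm sm /and4P[em x2m y2m xn2m].
have line (k a : z25) m below above : mbit a m -> mbit (a - k)%R below -> mbit (a + k)%R above ->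
    mbit a (line_mask k m below above).
  by rewrite mbit_line_mask => -> -> ->.
case: v; rewrite /line_of /slot_of /unattacked ?zsubE.
- by apply: line; rewrite // addrC.
- exact: line.
- apply: line => //; rewrite -[zadd x y]/(x + y)%R.
    by have -> : (x + y - (y - x) = x + x)%R by ring.
  by have -> : (x + y + (y - x) = y + y)%R by ring.
- apply: line => //; rewrite -[zadd x y]/(x + y)%R.
    by have -> : (y - x - (x + y) = - (x + x))%R by ring.
  by have -> : (y - x + (x + y) = y + y)%R by ring.
have row : mbit y (line_mask x my md ms) by apply: line; rewrite // addrC.
rewrite mbitE sel_digitwise (_ : box_x _ _ = x); last by by_inspection.
by rewrite xm rselE res_zbox (_ : quo (box_slot x y) = quo y) -?mbitE //; by_inspection.
Qed.

Definition misses (m : mask) (g : z25 -> z25) (D : seq z25) : Prop :=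
  forall t, mbit t m = (t \notin map g D).

Lemma misses_nil g : misses full_mask g [::]. Proof. exact: mbit_full. Qed.

Lemma misses_cons m g D x : misses m g D -> misses (mclear (g x) m) g (x :: D).
Proof. by move=> missD t; rewrite mbit_clear missD inE negb_or. Qed.

Section Soundness.
Variables (t : box_type) (p : z25 -> z25).
Hypotheses (queens_p : acyclic_queens p) (type_p : has_type t p).

Definition used (k : z25) (D : seq z25) : nat := count (fun x => zbox x (p x) == k) D.

Record records (s : state) (D : seq z25) : Prop := Records {
  records_rows : misses (rows s) id D;
  records_cols : misses (cols s) p D;
  records_diffs : misses (diffs s) (fun x => p x - x)%R D;
  records_sums : misses (sums s) (fun x => x + p x)%R D;
  records_codiffs : misses (codiffs s) (fun x => x - p x)%R D;
  records_dbl_rows : misses (dbl_rows s) (fun x => x + x)%R D;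
  records_dbl_cols : misses (dbl_cols s) (fun x => p x + p x)%R D;
  records_opp_dbl_rows : misses (opp_dbl_rows s) (fun x => - (x + x))%R D;
  records_uniq : uniq D;
  records_placed : forall x, aget (placed s) x = if x \in D then Some (p x) else None;
  records_room : forall k, aget (room s) k + used k D = nth 0 t k }.

Lemma leq_used k D : uniq D -> used k D <= nth 0 t k.
Proof.
move=> uniq_D; rewrite -type_p /used -size_filter /boxcount -(card_uniqP (filter_uniq _ uniq_D)).
by apply: subset_leq_card; apply/subsetP=> x; rewrite mem_filter inE => /andP[].
Qed.

Lemma records_place s D x : x \notin D -> records s D -> records (place s x (p x)) (x :: D).
Proof.
case: s => mx my md ms me m2x m2y mn2x f r xD [] /=.
move=> recx recy recd recs rece rec2x rec2y recn2x uniq_D recf recr.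
have uniq_xD : uniq (x :: D) by rewrite /= xD.
split=> //=.
- exact: misses_cons.
- exact: misses_cons.
- by rewrite zsubE; apply: (misses_cons (g := fun x => p x - x)%R).
- exact: (misses_cons (g := fun x => x + p x)%R).
- by rewrite zsubE; apply: (misses_cons (g := fun x => x - p x)%R).
- exact: (misses_cons (g := fun x => x + x)%R).
- exact: (misses_cons (g := fun x => p x + p x)%R).
- exact: (misses_cons (g := fun x => - (x + x))%R).
- by move=> z; rewrite aget_amod inE recf; case: eqP => [->|].
move=> k; rewrite aget_amod; have := leq_used k uniq_xD; rewrite -(recr k) /used /=.
by rewrite [k == _]eq_sym; case: (_ == k); lia.
Qed.

Lemma room_gt0 s D x : records s D -> x \notin D -> has_room (room s) (zbox x (p x)).
Proof.
move=> rec_s xD; have uniq_xD : uniq (x :: D) by rewrite /= xD (records_uniq rec_s).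
have := leq_used (zbox x (p x)) uniq_xD; rewrite -(records_room rec_s) /used /= eqxx /has_room.
by case: (aget _ _); lia.
Qed.

Lemma free_queen s D x : records s D -> x \notin D -> free_cell s x (p x).
Proof.
move=> rec_s xD; have [p_inj sub_inj _] := queens_p; have add_inj := queens_add_inj queens_p.
have free m (g : z25 -> z25) : misses m g D -> injective g -> mbit (g x) m.
  by move=> -> g_inj; rewrite mem_map.
rewrite /free_cell (free _ _ (records_rows rec_s) (@inj_id _)) (free _ _ (records_cols rec_s) p_inj).
rewrite (free _ _ (records_diffs rec_s) sub_inj) (free _ _ (records_sums rec_s) add_inj).
rewrite (free _ _ (records_dbl_rows rec_s) addzz_inj) /=.
rewrite (free _ _ (records_codiffs rec_s)) => [|a b eq_ab]; last first.
  by apply: sub_inj; rewrite /= -opprB eq_ab opprB.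
rewrite (free _ _ (records_dbl_cols rec_s)) => [|a b /addzz_inj/p_inj //].
by apply: free (records_opp_dbl_rows rec_s) _ => a b /oppr_inj/addzz_inj.
Qed.

Lemma open_line_queen s D v k : records s D -> open_line s v k ->
  exists2 x, x \notin D & line_of v x (p x) = k.
Proof.
move=> rec_s; have [p_inj sub_inj _] := queens_p; have add_inj := queens_add_inj queens_p.
have hit m (g : z25 -> z25) : misses m g D -> injective g -> mbit k m ->
    exists2 x, x \notin D & g x = k.
  move=> -> g_inj; have [h _ hK] := injF_bij g_inj; rewrite -[k in k \notin _]hK mem_map // => hD.
  by exists (h k).
case: v => /=.
- exact: hit (records_rows rec_s) (@inj_id _).
- exact: hit (records_cols rec_s) p_inj.
- move/(hit _ _ (records_diffs rec_s) sub_inj) => [x xD <-].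
  by exists x; rewrite ?zsubE.
- exact: hit (records_sums rec_s) add_inj.
move=> room_k; suff /existsP[x /andP[xD /eqP xk]] : [exists x, (x \notin D) && (zbox x (p x) == k)].
  by exists x.
apply: contraTT room_k; rewrite negb_exists => /forallP notin_D.
have: boxcount p k <= used k D.
  rewrite /used -size_filter /boxcount -(card_uniqP (filter_uniq _ (records_uniq rec_s))).
  apply: subset_leq_card; apply/subsetP=> x; rewrite mem_filter inE => xk.
  by have := notin_D x; rewrite xk andbT negbK.
by rewrite type_p -(records_room rec_s) /has_room; case: (aget _ _) => // n; lia.
Qed.

Lemma closes_sound s D n i x a : records s D -> closes n (placed s) i x a ->
  a \in D /\ exists2 m, 0 < m <= n & iter m (fun z => p z - i)%R a = x.
Proof.
move=> rec_s; elim: n a => //= n IHn a; rewrite (records_placed rec_s); case: ifP => // aD.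
rewrite zeqE zsubE; case: eqP => [<- _|_ /IHn[_ [m /andP[_ m_le] cycle_m]]]; split=> //; first by exists 1.
by exists m.+1; rewrite // iterSr.
Qed.

#[local] Arguments closes : simpl never.

Lemma closes_absurd s D i x : records s D -> x \notin D ->
  ~ closes 6 (placed s) i x (zsub (p x) i).
Proof.
move=> rec_s xD /(closes_sound rec_s)[aD [m /andP[_ m_le] cycle_m]]; rewrite zsubE in aD cycle_m.
have xE : (p x - i)%R = x by apply: (queens_acyclic queens_p (m := m.+1)); rewrite // iterSr.
by rewrite xE (negPf xD) in aD.
Qed.

Variable known : seq pattern.
Hypothesis known_refuted : forall pat, pat \in known -> refuted t pat.
Let st := symmetries t.
Let anchored := anchors known.

Lemma occupied_image_absurd s D x u sw j : records s D -> x \notin D ->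
  ~ occupied_image st anchored (placed s) x (p x) u sw j.
Proof.
move=> rec_s xD; rewrite /occupied_image; case anchorE: onth => [[c pat]|//].
have {anchorE} pat_known : pat \in known.
  have /allpairsPdep[pat' [c' [? _ [_ ->]]]] // : (c, pat) \in anchored.
  by apply/onthP; exists (Byte.to_nat j).
move: (zsub x _) (zsub (p x) _) => tx ty; rewrite is_symmetryE.
case: ifP => // /andP[u_unit /allP fixes_t] occ.
have [q [queens_q countE qE]] := queens_move tx ty sw u_unit queens_p.
apply: (known_refuted pat_known queens_q) => [k|].
  by rewrite countE type_p; apply/eqP/fixes_t/mem_z25s.
elim: pat occ {pat_known} => //= c' pat IHpat; case occ_c: occupied => // /IHpat ->.
rewrite andbT qE; move: occ_c; rewrite /occupied !zeqE; case: eqP => [->|_]; first by rewrite eq_sym.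
by rewrite (records_placed rec_s); case: ifP => // _; rewrite zeqE.
Qed.

Lemma check_sound n s D v k l : records s D -> ~ check st anchored n s v k l.
Proof.
elim: n s D v k l => //= n IHn s D v k l rec_s.
case: ifP => // /(open_line_queen rec_s)[x xD <-].
have := unattacked_free v (free_queen rec_s xD); rewrite -mem_elements.
have xK := cellxK v x (p x); have yK := cellyK v x (p x).
elim: (elements _) l => // t' ts IHts l; rewrite inE; case: eqP => [<- _|_ /= x_in].
  rewrite xK yK; have := room_gt0 rec_s xD; rewrite /has_room; case: (aget _ _) => // _ _.
  case: l => // b l; case: (decode b) => [v' k'|i|u sw].
  - by have := IHn _ _ v' k' l (records_place xD rec_s); case: check.
  - by have := closes_absurd (i := i) rec_s xD; case: closes.
  by case: l => // j l; have := occupied_image_absurd (u := u) (sw := sw) (j := j) rec_s xD;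
     case: occupied_image.
case: (aget _ _) => [|_]; first exact: IHts.
case: l => // b l.
by case: (match decode b with Split _ _ => _ | Cycle _ => _ | Image _ _ => _ end) => // l'; apply: IHts.
Qed.
End Soundness.

(* A list of bytes, with few constructors for each byte of a long certificate. *)
Inductive rope : Set :=
  Leaf (a b c d e f g h i j k l m n o p : byte) | Join (r r' : rope).
Fixpoint bytes (r : rope) (l : seq byte) : seq byte :=
  match r with
  | Leaf a b c d e f g h i j k q m n o p => [:: a, b, c, d, e, f, g, h, i, j, k, q, m, n, o, p & l]
  | Join r r' => bytes r (bytes r' l)
  end.

Definition state0 (t : box_type) : state :=
  State full_mask full_mask full_mask full_mask full_mask full_mask full_mask full_mask
    (amake (fun=> None)) (amake (fun k => nth 0 t k)).
Definition state_of (t : box_type) (pat : pattern) : state :=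
  foldr (fun c s => place s c.1 c.2) (state0 t) pat.
Definition refutes (t : box_type) (known : seq pattern) (pat : pattern) (r : rope) : bool :=
  if bytes r [::] is b :: l then
    if decode b is Split v k then
      if check (symmetries t) (anchors known) 26 (state_of t pat) v k l is Some _ then
        uniq [seq nat_of_z25 c.1 | c <- pat]
      else false
    else false
  else false.

Lemma records_state_of t p pat : has_type t p -> contains p pat -> uniq [seq c.1 | c <- pat] ->
  records t p (state_of t pat) [seq c.1 | c <- pat].
Proof.
move=> type_p; elim: pat => [_ _|[x y] pat IHpat].
  by split=> // [||||||||x|k]; rewrite ?aget_amake ?addn0 //; apply: misses_nil.
rewrite /contains /= => /andP[/eqP <- in_pat] /andP[x_notin uniq_pat].
exact: records_place (IHpat in_pat uniq_pat).
Qed.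

Lemma refutes_sound t known pat r : (forall pat', pat' \in known -> refuted t pat') ->
  refutes t known pat r -> refuted t pat.
Proof.
rewrite /refutes => known_refuted; case: bytes => // b l; case: decode => // v k.
case checked: check => //; rewrite (map_comp nat_of_z25 fst) (map_inj_uniq (can_inj nat_of_z25K)).
move=> uniq_pat p queens_p type_p in_pat.
have := check_sound queens_p type_p known_refuted (v := v) (k := k) (n := 26) (l := l)
  (records_state_of type_p in_pat uniq_pat).
by rewrite checked.
Qed.

(* The kernel reduces a closed term without constants much faster, hence this version of [refutes] in which
   every table is bound by an abstraction. *)
Definition refutes_in := ltac:(
  let body := eval cbv delta [refutes check bytes state_of state0 amake quint_of full_mask has_room elements
    unattacked place cellx celly open_line rows cols diffs sums placed room closes occupied_image all_occupied
    occupied movex movey is_symmetry symmetries onth anchors foldr fst snd predn] in refutes in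
  let body := eval pattern @aget, @amod, @rsel, zadd, zsub, zmul, zeq, zopp, zbox, box_x, box_y,
    zhalf_sub, zhalf_add, mbit, mclear, mshift, digit_and, push_digits, decode, line_mask, digitwise
    in body in
  lazymatch body with ?f _ _ _ _ _ _ _ _ _ _ _ _ _ _ _ _ _ _ _ _ _ => exact f end).
Notation refutes_tables :=
  (refutes_in (@aget) (@amod) (@rsel) zadd zsub zmul zeq zopp zbox box_x box_y
    zhalf_sub zhalf_add mbit mclear mshift digit_and push_digits decode line_mask digitwise).
Definition refutes_inlined : box_type -> seq pattern -> pattern -> rope -> bool :=
  Eval cbv delta [aget amod rsel zadd zsub zmul zeq zopp zbox box_x box_y
  zhalf_sub zhalf_add mbit mclear mshift digit_and push_digits decode line_mask mand digitwise]
  in refutes_tables.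

Lemma refutes_tablesE : refutes_tables = refutes. Proof. reflexivity. Qed.

Lemma refutes_inlinedE : refutes_inlined = refutes.
Proof. by rewrite -refutes_tablesE; reflexivity. Qed.

(** * Search for certificates *)

(* Nothing has to be proved about this search. *)
Record cell : Type := Cell { cx : z25; cy : z25; cd : z25; cs : z25 }.
Definition mkcell (x y : z25) : cell := Cell x y (zsub y x) (zadd x y).
Definition cell_line (v : dir) (c : cell) : z25 :=
  match v with
  | Row => cx c | Col => cy c | Diag => cd c | Anti => cs c | Box => zbox (cx c) (cy c)
  end.
Definition cell_slot (v : dir) (c : cell) : z25 :=
  match v with
  | Row => cy c | Col => cx c | Diag => cs c | Anti => cd c | Box => box_slot (cx c) (cy c)
  end.

Record node : Type := Node { base : state; inverse : arr (option z25); queens : seq cell }.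
Definition add_queen (s : node) (x y : z25) : node :=
  Node (place (base s) x y) (amod (fun=> Some x) (inverse s) y) (mkcell x y :: queens s).

Definition byte_of_nat (n : nat) : byte := if Byte.of_nat n is Some b then b else x00.
Definition split_byte : dir -> z25 -> byte := Eval vm_compute in fun v : dir =>
  match v with
  | Row => tab25 (fun k : z25 => byte_of_nat k)
  | Col => tab25 (fun k : z25 => byte_of_nat (25 + k))
  | Diag => tab25 (fun k : z25 => byte_of_nat (50 + k))
  | Anti => tab25 (fun k : z25 => byte_of_nat (75 + k))
  | Box => tab25 (fun k : z25 => byte_of_nat (100 + k))
  end.
Definition cycle_byte : z25 -> byte := Eval vm_compute in tab25 (fun i : z25 => byte_of_nat (125 + i)).
Definition image_byte : z25 -> bool -> byte := Eval vm_compute in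
  fun (u : z25) (sw : bool) =>
    if sw then tab25 (fun u => byte_of_nat (151 + 2 * index u units)) u
    else tab25 (fun u => byte_of_nat (150 + 2 * index u units)) u.

(* An image of a refuted pattern that contains a given queen: the other cells and the translation, relative
   to this queen, the linear part of the symmetry, and the anchor of the second cell. *)
Record image : Type := PatternImage {
  second_cell : z25 * z25; third_cell : option (z25 * z25); shift : z25 * z25; linear : z25 * bool;
  anchor : nat }.
(* As translations by multiples of 5 preserve every box, the images of a pattern through a cell depend on its
   box only; they are all listed when the pattern has two cells. *)
Record context : Type := Context {
  sym_table : arr (quint (bool * bool));
  images_by_second : arr (arr (seq image));
  pair_images : arr (seq image) }.

Definition is_image (c : context) (e : image) (q : cell) : bool :=
  is_symmetry (sym_table c) (linear e).1 (zadd (cx q) (shift e).1) (zadd (cy q) (shift e).2)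
    (linear e).2.

Definition images_of (pat : pattern) (j : nat) : seq image :=
  flatten [seq
    let g := [seq (movex us.1 z0 us.2 c, movey us.1 z0 us.2 c) | c <- pat] in
    let sub a b : z25 * z25 := (zsub a.1 b.1, zsub a.2 b.2) in
    let from a b i o := PatternImage (sub b a) o (sub (z0, z0) a) us (j + i) in
    match g with
    | [:: a; b] => [:: from a b 1 None; from b a 0 None]
    | [:: a; b; c] =>
      [:: from a b 1 (Some (sub c a)); from a c 2 (Some (sub b a));
          from b a 0 (Some (sub c b)); from b c 2 (Some (sub a b));
          from c a 0 (Some (sub b c)); from c b 1 (Some (sub a c))]
    | _ => [::]
    end | us <- [seq (u, sw) | u <- units, sw <- [:: false; true]]].
Fixpoint all_images (known : seq pattern) (j : nat) : seq image :=
  if known is pat :: known' then images_of pat j ++ all_images known' (j + size pat) else [::].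
Definition context_of (t : box_type) (known : seq pattern) : context :=
  let st := symmetries t in
  let l := all_images known 0 in
  let add e := amod (fun r => amod (cons e) r (second_cell e).2) ^~ (second_cell e).1 in
  let c := Context st (foldr add (amake (fun=> amake (fun=> [::]))) l) (amake (fun=> [::])) in
  Context st (images_by_second c) (amake (fun k =>
    let corner := mkcell (box_corner k).1 (box_corner k).2 in
    [seq e <- l | if third_cell e is None then is_image c e corner else false])).

(* [x] and [y] are supposed to be free. *)
Definition add_free (s : state) (x y : z25) (l : seq cell) : seq cell :=
  let d := zsub y x in
  if mbit d (diffs s) then
    let e := zadd x y in if mbit e (sums s) then Cell x y d e :: l else l
  else l.

(* [kill_path] follows [z => p z - i] from [a] to the first row [u] without a queen, and [path_start] follows
   it backwards from [x] to the column [c] such that a queen in [(u, c)] would close the path; [n] bounds the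
   length of this cycle. *)
Fixpoint path_start (n : nat) (g : arr (option z25)) (i x : z25) : option z25 :=
  if n is n'.+1 then
    let c := zadd x i in if aget g c is Some w then path_start n' g i w else Some c
  else None.
Fixpoint kill_path (n : nat) (f g : arr (option z25)) (s : state) (i a x : z25) (l : seq cell) : seq cell :=
  if n is n'.+1 then
    if aget f a is Some b then kill_path n' f g s i (zsub b i) x l
    else if path_start n g i x is Some c then add_free s a c l else l
  else l.
(* The free cells that would close a cycle of length at most 7 through the new queen [(x, y)] and an old one
   next to it. *)
Fixpoint kill_cycles (qs : seq cell) (f g : arr (option z25)) (s : state) (x y : z25) (l : seq cell)
    : seq cell :=
  if qs is Cell a b _ _ :: qs' then
    let i := zsub y a in
    let l := kill_path 5 f g s i (zsub b i) x l in
    let i := zsub b x in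
    kill_cycles qs' f g s x y (kill_path 5 f g s i (zsub y i) a l)
  else l.

Fixpoint kill_thirds (c : context) (es : seq image) (q : cell) (s : state) (l : seq cell) : seq cell :=
  if es is e :: es' then
    kill_thirds c es' q s
      (if third_cell e is Some (a, b) then
         let x := zadd (cx q) a in let y := zadd (cy q) b in
         if mbit x (rows s) then if mbit y (cols s) then
           if is_image c e q then add_free s x y l else l else l else l
       else l)
  else l.
Fixpoint kill_triples (c : context) (qs : seq cell) (s : state) (x y : z25) (l : seq cell) : seq cell :=
  if qs is q :: qs' then
    kill_triples c qs' s x y
      (kill_thirds c (aget (aget (images_by_second c) (zsub x (cx q))) (zsub y (cy q))) q s l)
  else l.
Fixpoint kill_pairs (es : seq image) (x y : z25) (s : state) (l : seq cell) : seq cell :=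
  if es is e :: es' then
    let x' := zadd x (second_cell e).1 in let y' := zadd y (second_cell e).2 in
    kill_pairs es' x y s (if mbit x' (rows s) then if mbit y' (cols s) then add_free s x' y' l else l else l)
  else l.

Definition killed_cells (c : context) (s s' : node) (x y : z25) : seq cell :=
  let l := kill_cycles (queens s) (placed (base s)) (inverse s) (base s') x y [::] in
  let l := kill_triples c (queens s) (base s') x y l in
  kill_pairs (aget (pair_images c) (zbox x y)) x y (base s') l.

Fixpoint cycle_reason (qs : seq cell) (f : arr (option z25)) (x y : z25) : option byte :=
  if qs is q :: qs' then
    let i := zsub y (cx q) in
    if closes 5 f i x (zsub (cy q) i) then Some (cycle_byte i) else cycle_reason qs' f x y
  else None.
Fixpoint find_image (c : context) (es : seq image) (q : cell) (f : arr (option z25)) : option image :=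
  if es is e :: es' then
    if (if third_cell e is Some (a, b) then
          if aget f (zadd (cx q) a) is Some w then zeq w (zadd (cy q) b) else false
        else true) && is_image c e q
    then Some e else find_image c es' q f
  else None.
Fixpoint image_reason (c : context) (qs : seq cell) (f : arr (option z25)) (x y : z25) : option image :=
  if qs is q :: qs' then
    if find_image c (aget (aget (images_by_second c) (zsub x (cx q))) (zsub y (cy q))) q f is Some e
    then Some e else image_reason c qs' f x y
  else None.
(* Certificates are built backwards. *)
Definition reason (c : context) (s : node) (x y : z25) (l : seq byte) : option (seq byte) :=
  let f := placed (base s) in
  if aget (room (base s)) (zbox x y) is 0 then Some l else
  if cycle_reason (queens s) f x y is Some b then Some (b :: l) else
  if image_reason c (queens s) f x y is Some e
  then Some [:: byte_of_nat (anchor e), image_byte (linear e).1 (linear e).2 & l] else None.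

Inductive line : Type := Line (v : dir) (k : z25) (m : mask).

Definition zlt : rel z25 := Eval vm_compute in tab25_2 (fun a b : z25 => a < b).
Definition digit_card : digit -> z25 := Eval vm_compute in
  tab32 (fun d => z25_of_nat (count (bit^~ d) (iota 0 5))).
Definition digit_card2 : digit -> digit -> z25 := Eval vm_compute in
  fun a b => tab32 (fun a => tab32 (fun b => zadd (digit_card a) (digit_card b)) b) a.
Definition zadd_sat : z25 -> z25 -> z25 := Eval vm_compute in
  tab25_2 (fun a b : z25 => z25_of_nat (minn 24 (a + b))).
Definition mask_card (m : mask) : z25 :=
  let: Quint a b c d e := m in zadd_sat (zadd (digit_card2 a b) (digit_card2 c d)) (digit_card e).

(* The slots left by a queen in slot [t] of another line of the same direction, at distance [h]; when the
   queen fills its box, it also takes the slots of this box. *)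
Definition unattacked_slots : z25 -> z25 -> mask := Eval vm_compute in
  tab25_2 (fun h t => mclear t (mclear (zadd t h) (mclear (zsub t h) full_mask))).
Definition unattacked_full : z25 -> z25 -> mask := Eval vm_compute in
  tab25_2 (fun h t => let m := unattacked_slots h t in if res h == 0 then upd (res t) (fun=> d0) m else m).
(* The slots of a box left by a queen, given its coordinates relative to the corner of the box. *)
Definition unattacked_box : z25 -> z25 -> mask := Eval vm_compute in
  tab25_2 (fun x y => digitwise (fun i => digit_of_bits (fun j =>
    let a := z25_of_nat (5 * i) in let b := z25_of_nat (5 * j) in
    ~~ [|| a == x, b == y, zsub b a == zsub y x | zadd a b == zadd x y]))).
Definition box_cornerx : z25 -> z25 := Eval vm_compute in tab25 (fun k => (box_corner k).1).
Definition box_cornery : z25 -> z25 := Eval vm_compute in tab25 (fun k => (box_corner k).2).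
Definition attack (full : bool) (q : cell) (v : dir) (k h : z25) (m : mask) : mask :=
  match v with
  | Box => mand m (unattacked_box (zsub (cx q) (box_cornerx k)) (zsub (cy q) (box_cornery k)))
  | _ => mand m (if full then unattacked_full h (cell_slot v q) else unattacked_slots h (cell_slot v q))
  end.

(* The cells that a new queen kills without attacking them, and the lines of each direction that contain none
   of these cells. *)
Record kills : Type := Kills {
  killed : seq cell;
  spared_rows : mask; spared_cols : mask; spared_diags : mask; spared_antis : mask; spared_boxes : mask }.
Fixpoint kills_of (l l0 : seq cell) (a b c d e : mask) : kills :=
  if l is Cell x y u v :: l' then
    kills_of l' l0 (mclear x a) (mclear y b) (mclear u c) (mclear v d) (mclear (zbox x y) e)
  else Kills l0 a b c d e.
Definition spared_lines (ks : kills) (v : dir) : mask :=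
  match v with
  | Row => spared_rows ks | Col => spared_cols ks | Diag => spared_diags ks | Anti => spared_antis ks
  | Box => spared_boxes ks
  end.
Fixpoint remove_cells (l : seq cell) (v : dir) (k : z25) (m : mask) : mask :=
  if l is c :: l' then
    remove_cells l' v k (if zeq (cell_line v c) k then mclear (cell_slot v c) m else m)
  else m.

Inductive outcome : Type :=
  | Dead_end (v : dir) (k : z25)
  | Choice (ls : seq line) (n : z25) (v : dir) (k : z25) (m : mask).
(* A line that loses all its live cells is returned alone. *)
Fixpoint attack_lines (full : bool) (q : cell) (ls acc : seq line) : seq line :=
  if ls is Line v k m :: ls' then
    let k0 := cell_line v q in
    if (if zeq k k0 then if v is Box then full else true else false)
    then attack_lines full q ls' acc else
    match attack full q v k (zsub k k0) m with
    | Quint d0 d0 d0 d0 d0 => [:: Line v k no_mask]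
    | m => attack_lines full q ls' (Line v k m :: acc)
    end
  else acc.
(* Selects a line with the fewest live cells and forgets the lines with more than [bound] of them. *)
Fixpoint choose_line (bound : z25) (ks : kills) (ls acc : seq line)
    (n0 : z25) (v0 : dir) (k0 : z25) (m0 : mask) : outcome :=
  if ls is Line v k m :: ls' then
    let m := if mbit k (spared_lines ks v) then m else remove_cells (killed ks) v k m in
    let n := mask_card m in
    if n is z0 then Dead_end v k else
    if zlt n n0 then choose_line bound ks ls' (Line v k m :: acc) n v k m
    else choose_line bound ks ls' (if zlt bound n then acc else Line v k m :: acc) n0 v0 k0 m0
  else Choice acc n0 v0 k0 m0.

Definition live_mask (c : context) (s : node) (v : dir) (k : z25) : mask :=
  let m := unattacked (base s) v k in
  foldr (fun t m => if reason c s (cellx v k t) (celly v k t) [::] is Some _ then mclear t m else m)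
    m (elements m).
Definition all_lines (c : context) (s : node) : seq line :=
  flatten [seq [seq Line v k (live_mask c s v k) | k <- z25s & open_line (base s) v k]
    | v <- [:: Row; Col; Diag; Anti; Box]].
Definition choose_fresh_line (c : context) (s : node) : outcome :=
  choose_line z24 (Kills [::] full_mask full_mask full_mask full_mask full_mask) (all_lines c s) [::]
    z24 Row z0 full_mask.

Definition step (bound : z25) (c : context) (s s' : node) (ls : seq line) (x y : z25) : outcome :=
  let full := ~~ has_room (room (base s')) (zbox x y) in
  match attack_lines full (mkcell x y) ls [::] with
  | [:: Line v k (Quint d0 d0 d0 d0 d0)] => Dead_end v k
  | ls =>
    let l := killed_cells c s s' x y in
    match choose_line bound (kills_of l l full_mask full_mask full_mask full_mask full_mask) ls [::]
      z24 Row z0 full_mask with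
    | Choice [::] _ _ _ _ => choose_fresh_line c s'
    | r => r
    end
  end.

Fixpoint find_certificate (c : context) (n : nat) (s : node) (ls : seq line) (v : dir) (k : z25) (m : mask)
    (l : seq byte) : seq byte :=
  if n is n'.+1 then
    (fix certify_cells (ts : seq z25) (l : seq byte) : seq byte :=
      if ts is t :: ts' then
        let x := cellx v k t in let y := celly v k t in
        certify_cells ts' (
          if mbit t m then
            let s' := add_queen s x y in
            match step (if n <= 17 then z3 else z24) c s s' ls x y with
            | Dead_end v k => find_certificate c n' s' [::] v k no_mask l
            | Choice ls _ v k m => find_certificate c n' s' ls v k m l
            end
          else odflt l (reason c s x y l))
      else l) (elements (unattacked (base s) v k)) (split_byte v k :: l)
  else l.

Fixpoint leaves (n : nat) (cur l : seq byte) (acc : seq rope) : seq rope :=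
  if l is x :: l' then
    if n is 15 then
      if x :: cur is [:: a; b; c; d; e; f; g; h; i; j; k; q; m; n; o; p]
      then leaves 0 [::] l' (Leaf a b c d e f g h i j k q m n o p :: acc) else acc
    else leaves n.+1 (x :: cur) l' acc
  else acc.
(* Bytes to be added at the end of a certificate that is built backwards. *)
Fixpoint padding (n : nat) (l : seq byte) : nat :=
  if l is _ :: l' then padding (if n is 0 then 15 else n.-1) l' else n.
Fixpoint join_pairs (l : seq rope) : seq rope :=
  if l is a :: b :: l' then Join a b :: join_pairs l' else l.
Definition rope_of (l : seq byte) : rope :=
  head (Leaf x00 x00 x00 x00 x00 x00 x00 x00 x00 x00 x00 x00 x00 x00 x00 x00)
    (iter 40 join_pairs (leaves 0 [::] (nseq (padding 0 l) x00 ++ l) [::])).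

Definition search (t : box_type) (known : seq pattern) (pat : pattern) : seq byte :=
  let c := context_of t known in
  let s := foldr (fun c s => add_queen s c.1 c.2) (Node (state0 t) (amake (fun=> None)) [::]) pat in
  match choose_fresh_line c s with
  | Dead_end v k => find_certificate c (26 - size pat) s [::] v k no_mask [::]
  | Choice ls _ v k m => find_certificate c (26 - size pat) s ls v k m [::]
  end.
Definition certificate (t : box_type) (known : seq pattern) (pat : pattern) : rope :=
  rope_of (search t known pat).

(** * The box types are infeasible *)

(* A refuted pattern makes its extensions redundant. *)
Definition learn (pat : pattern) (known : seq pattern) : seq pattern :=
  pat :: [seq pat' <- known | ~~ all [in pat'] pat].

Fixpoint refutes_all (t : box_type) (known pats : seq pattern) (rs : seq rope) : bool :=
  match pats, rs with
  | pat :: pats', r :: rs' =>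
    if refutes_inlined t known pat r then refutes_all t (learn pat known) pats' rs' else false
  | [::], [::] => true
  | _, _ => false
  end.

Lemma refutes_all_sound t known pats rs : (forall pat, pat \in known -> refuted t pat) ->
  refutes_all t known pats rs -> forall pat, pat \in pats -> refuted t pat.
Proof.
elim: pats known rs => [|pat pats IHpats] known [|r rs] //= known_refuted; rewrite refutes_inlinedE.
case pat_refutes: refutes => // /IHpats pats_refuted pat'; rewrite inE.
have pat_refuted := refutes_sound known_refuted pat_refutes.
case/predU1P=> [-> //|]; apply: pats_refuted => {}pat'; rewrite inE => /predU1P[-> //|].
by rewrite mem_filter => /andP[_ /known_refuted].
Qed.

Definition proves_infeasible (t : box_type) (pats : seq pattern) (rs : seq rope) : bool :=
  if last [::] pats is [:: (x, y)] then
    if nth 0 t (zbox x y) is 0 then false else refutes_all t [::] pats rs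
  else false.

Lemma proves_infeasibleP t pats rs : proves_infeasible t pats rs -> infeasible t.
Proof.
rewrite /proves_infeasible; case: (lastP pats) => //= {}pats pat; rewrite last_rcons.
case: pat => [//|[x y] [|//]]; case count: (nth 0 t (zbox x y)) => // all_refuted.
apply: (@infeasible_of_cell t x y); first by rewrite count.
by apply: (refutes_all_sound _ all_refuted) => //; rewrite mem_rcons mem_head.
Qed.

Fixpoint certificates (t : box_type) (known pats : seq pattern) : seq rope :=
  if pats is pat :: pats' then certificate t known pat :: certificates t (learn pat known) pats' else [::].

(* For every box type, patterns to be refuted in this order; the last one is a single cell of a nonempty box,
   and its case analysis benefits from the others, which are first moves of it. *)
Definition plan : seq (seq pattern) := [::
  [:: [:: (z22, z7); (z1, z6); (z0, z0)]; [:: (z2, z12); (z1, z6); (z0, z0)];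
      [:: (z12, z22); (z1, z6); (z0, z0)]; [:: (z9, z19); (z1, z6); (z0, z0)];
      [:: (z18, z3); (z1, z6); (z0, z0)]; [:: (z3, z13); (z1, z6); (z0, z0)];
      [:: (z23, z8); (z1, z6); (z0, z0)]; [:: (z4, z14); (z1, z6); (z0, z0)];
      [:: (z1, z6); (z0, z0)]; [:: (z7, z12); (z0, z0)]; [:: (z0, z0)]];
  [:: [:: (z15, z3); (z0, z1)]; [:: (z15, z12); (z0, z1)]; [:: (z15, z9); (z0, z1)]; [:: (z0, z1)]];
  [:: [:: (z5, z17); (z0, z1)]; [:: (z5, z23); (z0, z1)]; [:: (z5, z14); (z0, z1)]; [:: (z0, z1)]];
  [:: [:: (z13, z3); (z2, z2)]; [:: (z6, z21); (z2, z2)]; [:: (z2, z2)]];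
  [:: [:: (z24, z5); (z1, z2)]; [:: (z12, z18); (z1, z2)]; [:: (z1, z2)]];
  [:: [:: (z24, z11); (z3, z1)]; [:: (z16, z11); (z3, z1)]; [:: (z3, z1)]];
  [:: [:: (z22, z1); (z1, z0)]; [:: (z20, z24); (z1, z0)]; [:: (z1, z0)]];
  [:: [:: (z2, z11); (z1, z0)]; [:: (z20, z4); (z1, z0)]; [:: (z1, z0)]];
  [:: [:: (z5, z14); (z0, z3)]; [:: (z5, z7); (z0, z3)]; [:: (z0, z3)]];
  [:: [:: (z10, z4); (z0, z2)]; [:: (z10, z23); (z0, z2)]; [:: (z0, z2)]];
  [:: [:: (z6, z16); (z2, z2)]; [:: (z3, z13); (z2, z2)]; [:: (z2, z2)]];
  [:: [:: (z10, z22); (z0, z3)]; [:: (z10, z9); (z0, z3)]; [:: (z0, z3)]];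
  [:: [:: (z10, z9); (z0, z2)]; [:: (z10, z23); (z0, z2)]; [:: (z0, z2)]];
  [:: [:: (z10, z17); (z0, z3)]; [:: (z10, z19); (z0, z3)]; [:: (z0, z3)]];
  [:: [:: (z7, z10); (z2, z3)]; [:: (z7, z19); (z2, z3)]; [:: (z2, z3)]];
  [:: [:: (z0, z3)]];
  [:: [:: (z0, z3)]];
  [:: [:: (z0, z3)]];
  [:: [:: (z0, z3)]];
  [:: [:: (z0, z3)]];
  [:: [:: (z0, z4)]];
  [:: [:: (z0, z4)]];
  [:: [:: (z0, z4)]]].

Definition certificates_of (n : nat) : seq rope :=
  certificates (nth [::] box_types n) [::] (nth [::] plan n).

Definition infeasible_upto (n : nat) : Prop := forall t, t \in take n box_types -> infeasible t.

Lemma infeasible_uptoS n rs : infeasible_upto n -> n < 23 ->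
  proves_infeasible (nth [::] box_types n) (nth [::] plan n) rs = true -> infeasible_upto n.+1.
Proof.
move=> upto_n n_lt /proves_infeasibleP t_inf t; rewrite (take_nth [::]) // mem_rcons inE.
by case/predU1P=> [->|/upto_n].
Qed.

Lemma infeasible_upto0 : infeasible_upto 0. Proof. by []. Qed.

Ltac by_certificates upto rs :=
  apply: (@infeasible_uptoS _ rs upto isT); vm_cast_no_check (erefl true).

Definition certificates0 : seq rope := Eval vm_compute in certificates_of 0.
Lemma infeasible_upto1 : infeasible_upto 1. Proof. by_certificates infeasible_upto0 certificates0. Qed.

Definition certificates1 : seq rope := Eval vm_compute in certificates_of 1.
Lemma infeasible_upto2 : infeasible_upto 2. Proof. by_certificates infeasible_upto1 certificates1. Qed.

Definition certificates2 : seq rope := Eval vm_compute in certificates_of 2.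
Lemma infeasible_upto3 : infeasible_upto 3. Proof. by_certificates infeasible_upto2 certificates2. Qed.

Definition certificates3 : seq rope := Eval vm_compute in certificates_of 3.
Lemma infeasible_upto4 : infeasible_upto 4. Proof. by_certificates infeasible_upto3 certificates3. Qed.

Definition certificates4 : seq rope := Eval vm_compute in certificates_of 4.
Lemma infeasible_upto5 : infeasible_upto 5. Proof. by_certificates infeasible_upto4 certificates4. Qed.

Definition certificates5 : seq rope := Eval vm_compute in certificates_of 5.
Lemma infeasible_upto6 : infeasible_upto 6. Proof. by_certificates infeasible_upto5 certificates5. Qed.

Definition certificates6 : seq rope := Eval vm_compute in certificates_of 6.
Lemma infeasible_upto7 : infeasible_upto 7. Proof. by_certificates infeasible_upto6 certificates6. Qed.

Definition certificates7 : seq rope := Eval vm_compute in certificates_of 7.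
Lemma infeasible_upto8 : infeasible_upto 8. Proof. by_certificates infeasible_upto7 certificates7. Qed.

Definition certificates8 : seq rope := Eval vm_compute in certificates_of 8.
Lemma infeasible_upto9 : infeasible_upto 9. Proof. by_certificates infeasible_upto8 certificates8. Qed.

Definition certificates9 : seq rope := Eval vm_compute in certificates_of 9.
Lemma infeasible_upto10 : infeasible_upto 10. Proof. by_certificates infeasible_upto9 certificates9. Qed.

Definition certificates10 : seq rope := Eval vm_compute in certificates_of 10.
Lemma infeasible_upto11 : infeasible_upto 11. Proof. by_certificates infeasible_upto10 certificates10. Qed.

Definition certificates11 : seq rope := Eval vm_compute in certificates_of 11.
Lemma infeasible_upto12 : infeasible_upto 12. Proof. by_certificates infeasible_upto11 certificates11. Qed.

Definition certificates12 : seq rope := Eval vm_compute in certificates_of 12.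
Lemma infeasible_upto13 : infeasible_upto 13. Proof. by_certificates infeasible_upto12 certificates12. Qed.

Definition certificates13 : seq rope := Eval vm_compute in certificates_of 13.
Lemma infeasible_upto14 : infeasible_upto 14. Proof. by_certificates infeasible_upto13 certificates13. Qed.

Definition certificates14 : seq rope := Eval vm_compute in certificates_of 14.
Lemma infeasible_upto15 : infeasible_upto 15. Proof. by_certificates infeasible_upto14 certificates14. Qed.

Definition certificates15 : seq rope := Eval vm_compute in certificates_of 15.
Lemma infeasible_upto16 : infeasible_upto 16. Proof. by_certificates infeasible_upto15 certificates15. Qed.

Definition certificates16 : seq rope := Eval vm_compute in certificates_of 16.
Lemma infeasible_upto17 : infeasible_upto 17. Proof. by_certificates infeasible_upto16 certificates16. Qed.

Definition certificates17 : seq rope := Eval vm_compute in certificates_of 17.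
Lemma infeasible_upto18 : infeasible_upto 18. Proof. by_certificates infeasible_upto17 certificates17. Qed.

Definition certificates18 : seq rope := Eval vm_compute in certificates_of 18.
Lemma infeasible_upto19 : infeasible_upto 19. Proof. by_certificates infeasible_upto18 certificates18. Qed.

Definition certificates19 : seq rope := Eval vm_compute in certificates_of 19.
Lemma infeasible_upto20 : infeasible_upto 20. Proof. by_certificates infeasible_upto19 certificates19. Qed.

Definition certificates20 : seq rope := Eval vm_compute in certificates_of 20.
Lemma infeasible_upto21 : infeasible_upto 21. Proof. by_certificates infeasible_upto20 certificates20. Qed.

Definition certificates21 : seq rope := Eval vm_compute in certificates_of 21.
Lemma infeasible_upto22 : infeasible_upto 22. Proof. by_certificates infeasible_upto21 certificates21. Qed.

Definition certificates22 : seq rope := Eval vm_compute in certificates_of 22.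
Lemma infeasible_upto23 : infeasible_upto 23. Proof. by_certificates infeasible_upto22 certificates22. Qed.

Lemma box_types_infeasible t : t \in box_types -> infeasible t.
Proof. exact: infeasible_upto23. Qed.

(** * Permutations of Z/25 *)

Definition to_Z25 (z : z25) : Z25 := inZp z.
Definition of_Z25 (i : Z25) : z25 := z25_of_nat i.

Lemma to_Z25K : cancel to_Z25 of_Z25. Proof. by case. Qed.

Lemma of_Z25K : cancel of_Z25 to_Z25.
Proof. by move=> i; apply: val_inj; rewrite /= z25_of_natK modn_mod modn_small. Qed.

Lemma to_Z25_inj : injective to_Z25. Proof. exact: can_inj to_Z25K. Qed.

Fact to_Z25_is_zmod_morphism : zmod_morphism to_Z25.
Proof. by move=> /= a b; by_inspection. Qed.

HB.instance Definition _ := GRing.isZmodMorphism.Build z25 'Z_25 to_Z25 to_Z25_is_zmod_morphism.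

Lemma image_translate (pi : {perm Z25}) (A : {set Z25}) (i : Z25) :
  (forall a, a \in A -> (pi a - i)%R \in A) -> pi @: A = translate A i.
Proof.
move=> stable_A; apply/eqP; rewrite eqEcard; apply/andP; split.
  apply/subsetP=> _ /imsetP[a aA ->]; apply/imsetP; exists (pi a - i)%R; first exact: stable_A.
  by rewrite subrK.
by rewrite /translate !card_imset //; [apply: addIr | apply: perm_inj].
Qed.

Section NoTranslatedImage.
Variable pi : {perm Z25}.
Hypothesis no_translate :
  forall (A : {set Z25}) (i : Z25), 2 <= #|A| <= 7 -> pi @: A <> translate A i.

Let p (z : z25) : z25 := of_Z25 (pi (to_Z25 z)).

Lemma stable_absurd (A : {set Z25}) (i : Z25) :
  (forall a, a \in A -> (pi a - i)%R \in A) -> 2 <= #|A| <= 7 -> False.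
Proof. by move=> /image_translate image_A /no_translate/(_ image_A). Qed.

Lemma short_cycle_fixed (i x : Z25) m : 0 < m <= 7 ->
  iter m (fun a => pi a - i)%R x = x -> (pi x - i)%R = x.
Proof.
move=> /andP[m_gt0 m_le]; set f := fun a => _ => cycle_x; apply/eqP/negPn/negP=> fx_neq.
have m_gt1 : 1 < m.
  by case: m m_gt0 cycle_x {m_le} => [//|[|//]] _ fx; rewrite -[(_ - i)%R]/(iter 1 f x) fx eqxx in fx_neq.
pose A : {set Z25} := [set iter (j : 'I_m) f x | j : 'I_m].
have memA j : j < m -> iter j f x \in A.
  by move=> j_lt; apply/imsetP; exists (Ordinal j_lt).
apply: (@stable_absurd A i) => [_ /imsetP[j _ ->]|].
  rewrite -[(_ - i)%R]/(iter j.+1 f x); have [->|j_neq] := eqVneq j.+1 m.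
    by rewrite cycle_x; apply: (memA 0).
  by apply: memA; rewrite ltn_neqAle j_neq ltn_ord.
apply/andP; split; last by rewrite (leq_trans (leq_imset_card _ _)) // cardT size_enum_ord.
have /subset_leq_card : [set x; f x] \subset A.
  by apply/subsetP=> a /set2P[->|->]; [apply: (memA 0) | apply: (memA 1)].
by apply: leq_trans; rewrite cards2 eq_sym fx_neq.
Qed.

Lemma acyclic_queens_of_perm : acyclic_queens p.
Proof.
have pE z : to_Z25 (p z) = pi (to_Z25 z) by apply: of_Z25K.
split=> [x y eq_p|x y /(congr1 to_Z25)|i x m m_bounds cycle_x].
- by apply: to_Z25_inj; apply: (@perm_inj _ pi); rewrite -!pE eq_p.
- rewrite !raddfB /= !pE => eq_sub; apply/eqP/negPn/negP=> xy_neq.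
  apply: (@stable_absurd [set to_Z25 x; to_Z25 y] (pi (to_Z25 x) - to_Z25 x)%R) => [a|].
    by case/set2P=> ->; [rewrite subKr set21 | rewrite eq_sub subKr set22].
  by rewrite cards2 (inj_eq to_Z25_inj) xy_neq.
apply: to_Z25_inj; rewrite raddfB /= pE; apply: (short_cycle_fixed m_bounds).
rewrite -[RHS](congr1 to_Z25 cycle_x).
by elim: (m) => //= n ->; rewrite raddfB /= pE.
Qed.
End NoTranslatedImage.
(* Found by a search among the permutations that commute with [x |-> 7 x]. *)
Definition witness_fun (z : z25) : z25 :=
  z25_of_nat (nth 0 [:: 0; 2; 21; 12; 16; 8; 20; 14; 10; 24; 6; 3; 7; 18; 22; 19; 1; 15; 11; 5; 17; 9; 13;
    4; 23] z).

Lemma witness_fun_inj : injective witness_fun.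
Proof. by move=> a b /eqP eq_w; apply/eqP; move: eq_w; apply/implyP; by_inspection. Qed.

Lemma witness_fun_sub_inj : injective (fun z => witness_fun z - z)%R.
Proof. by move=> a b /eqP eq_w; apply/eqP; move: eq_w; apply/implyP; by_inspection. Qed.

Lemma witness_fun_acyclic (c z : z25) n : 2 <= n <= 6 ->
  iter n (fun z => witness_fun (z + c)%R) z = z -> witness_fun (z + c)%R = z.
Proof.
move=> n_bounds /eqP cycle_z; apply/eqP; move: cycle_z; apply/implyP.
have /allP/(_ n) : all (fun n => (iter n (fun z => witness_fun (z + c)%R) z == z) ==>
    (witness_fun (z + c)%R == z)) (iota 2 5) by by_inspection.
by rewrite mem_iota; apply.
Qed.

Lemma witness_inj : injective (fun i : Z25 => to_Z25 (witness_fun (of_Z25 i))).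
Proof. exact: inj_comp to_Z25_inj (inj_comp witness_fun_inj (can_inj of_Z25K)). Qed.

Definition witness : {perm Z25} := perm witness_inj.

Lemma witnessE z : witness (to_Z25 z) = to_Z25 (witness_fun z).
Proof. by rewrite permE to_Z25K. Qed.

Lemma witness_sub_inj : injective (fun x : Z25 => witness x - x)%R.
Proof.
move=> i j; rewrite -[i]of_Z25K -[j]of_Z25K !witnessE -!raddfB.
by move=> /to_Z25_inj/witness_fun_sub_inj ->.
Qed.

Lemma witness_no_short_cycle k : no_short_cycle (shifted witness k).
Proof.
move=> x; set f := shifted witness k => order_bounds.
have f_inj : injective f by move=> a b /perm_inj/addIr.
pose g z := witness_fun (z + of_Z25 k)%R.
have fE z : f (to_Z25 z) = to_Z25 (g z).
  by rewrite /f /shifted -[k]of_Z25K -raddfD witnessE.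
have iter_fE n z : iter n f (to_Z25 z) = to_Z25 (iter n g z) by elim: n => //= n ->.
have fx : f x = x.
  have := iter_order f_inj x; rewrite -[x]of_Z25K iter_fE fE => /to_Z25_inj cycle_x.
  by congr to_Z25; apply: witness_fun_acyclic cycle_x; rewrite of_Z25K.
have := fingraph.orbit_uniq f x; rewrite /fingraph.orbit.
by case: (fingraph.order f x) order_bounds => [//|[//|n]] _; rewrite /= inE fx eqxx.
Qed.

Local Open Scope ring_scope.

Theorem proposition6p1 :
  (forall pi : {perm Z25}, exists (A : {set Z25}) (i : Z25),
      (2 <= #|A| <= 7)%N /\ pi @: A = translate A i) /\
  (exists pi : {perm Z25},
      injective (fun x : Z25 => pi x - x) /\
      forall k : Z25, no_short_cycle (shifted pi k)).
Proof.
split=> [pi|]; last first.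
  by exists witness; split; [exact: witness_sub_inj | exact: witness_no_short_cycle].
have [/existsP[A /existsP[i /andP[card_A /eqP image_A]]]|no_translate] :=
  boolP [exists A : {set Z25}, exists i, (2 <= #|A| <= 7)%N && (pi @: A == translate A i)].
  by exists A, i.
case: (no_acyclic_queens box_types_infeasible (acyclic_queens_of_perm (pi := pi) _)) => A i card_A image_A.
case/negP: no_translate; apply/existsP; exists A; apply/existsP; exists i.
by rewrite card_A image_A eqxx.
Qed.
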